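(* Let Assumption A be satisfied. Then there is a constant $C_1$, not depending on $m$, such that for all integers $m\ge 2$ (and with $m^*=2[m/2]$) $$\sup_{x\in\mathbb{R}}\left|\mathbb{P}_\theta\big(2p_0\sqrt{m^*}\,(M_m-\theta)\le x\big)-\Phi(x)-\frac{f_1(x)}{\sqrt{m^*}}-\frac{f_2(x)}{m^*}\right|\le \frac{C_1}{m^{3/2}},$$ where $$f_1(x)=\frac{p_1\,x|x|}{4p_0^2}\,\varphi(x),\qquad f_2(x)=\frac{x}{4}\Big(3+x^2+\frac{p_2x^2}{6p_0^3}-\frac{p_1^2x^4}{8p_0^4}\Big)\varphi(x).$$
   Context: Under $\mathbb{P}_\theta$, $\theta\in\mathbb{R}$, the observations $X_1,X_2,\ldots$ are independent real random variables with common density $p_X(x-\theta)$. With order statistics $X_{(1)}\le\cdots\le X_{(m)}$ of $X_1,\ldots,X_m$, the sample median is $M_m=X_{(j)}$ if $m=2j-1$ and $M_m=(X_{(j)}+X_{(j+1)})/2$ if $m=2j$. $[y]$ is the integer part of $y$, so $m^*=m$ for even $m$ and $m^*=m-1$ for odd $m$. $\Phi$ and $\varphi$ are the standard normal distribution function and density. Assumption A: the density $p_X$ is symmetric around zero, i.e. $p_X(-x)=p_X(x)$ for $x\in\mathbb{R}$, and $p_X(0)>0$; moreover $p_X$ has three continuous bounded derivatives in some interval $(0,x_0)$, $x_0>0$. Put $p_0=p_X(0)$, $p_1=p_X'(0+)$, $p_2=p_X''(0+)$.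
   Formalization: Assumption A is supplemented by right-continuity of p_X at 0, i.e. p_X(x)→p_X(0) as x→0+; without it p_0=p_X(0) could be changed at a single point without changing the law, and the expansion would fail. *)

(* Defs.v *)
From HB Require Import structures.
From mathcomp Require Export all_boot all_order all_algebra finmap.
From mathcomp Require Export all_classical all_reals all_analysis.

Set Implicit Arguments.
Unset Strict Implicit.
Unset Printing Implicit Defensive.

Export Order.TTheory GRing.Theory Num.Theory.
Export numFieldNormedType.Exports.

Local Open Scope classical_set_scope.
Local Open Scope ring_scope.

Definition is_density (R : realType) (p : R -> R) : Prop :=
  [/\ measurable_fun setT p, (forall x, 0 <= p x) &
      (\int[lebesgue_measure]_x (p x)%:E = 1)%E].

Definition has_density d (T : measurableType d) (R : realType)
    (P : probability T R) (X : {mfun T >-> R}) (p : R -> R) : Prop :=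
  forall A : set R, measurable A ->
    P (X @^-1` A) = (\int[lebesgue_measure]_(x in A) (p x)%:E)%E.

Definition independent_rvs d (T : measurableType d) (R : realType)
    (P : probability T R) (X : nat -> {mfun T >-> R}) : Prop :=
  forall (J : {fset nat}) (A : nat -> set R),
    (forall i, i \in J -> measurable (A i)) ->
    P (\bigcap_(i in [set` J]) (X i @^-1` A i)) =
    (\prod_(i <- J) P (X i @^-1` A i))%E.

(* [X i] is the observation X_{i+1}. *)
Definition location_sample d (T : measurableType d) (R : realType)
    (p : R -> R) (P : R -> probability T R) (X : nat -> {mfun T >-> R}) : Prop :=
  forall theta : R,
    independent_rvs (P theta) X /\
    forall i, has_density (P theta) (X i) (fun x => p (x - theta)).

(* The k-th smallest entry of [s], counted from 1. *)
Definition order_stat (R : realType) (s : seq R) (k : nat) : R :=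
  nth 0 (sort <=%R s) k.-1.

(* [uphalf m] is j when m = 2j - 1, and [m./2] is j when m = 2j. *)
Definition seq_median (R : realType) (s : seq R) : R :=
  let m := size s in
  if odd m then order_stat s (uphalf m)
  else (order_stat s m./2 + order_stat s (m./2).+1) / 2.

Definition sample_median d (T : measurableType d) (R : realType)
    (X : nat -> {mfun T >-> R}) (m : nat) (w : T) : R :=
  seq_median [seq X i w | i <- iota 0 m].

(* Right-continuity at 0 ties the value p(0), which is irrelevant to the law,
   to p on (0, x0), so that p(0) and the one-sided derivatives p'(0+), p''(0+)
   are the Taylor data of p at 0 from the right. *)
Definition assumptionA (R : realType) (p : R -> R) : Prop :=
  [/\ is_density p,
      (forall x, p (- x) = p x),
      0 < p 0,
      p x @[x --> 0^'+] --> p 0 &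
      exists2 x0 : R, 0 < x0 &
        (forall k (x : R), (k < 3)%N -> 0 < x < x0 -> derivable (derive1n k p) x 1) /\
        (forall k, (1 <= k <= 3)%N ->
           (forall x : R, 0 < x < x0 -> {for x, continuous (derive1n k p)}) /\
           exists M : R, forall x : R, 0 < x < x0 -> `|derive1n k p x| <= M)].

(* p^{(k)}(0+) *)
Definition right_deriv0 (R : realType) (p : R -> R) (k : nat) : R :=
  lim (derive1n k p x @[x --> 0^'+]).

Definition std_normal_pdf (R : realType) (x : R) : R := normal_pdf 0 1 x.

Definition std_normal_cdf (R : realType) (x : R) : R :=
  fine (normal_prob 0 1 `]-oo, x]).

Definition f1 (R : realType) (p : R -> R) (x : R) : R :=
  let p0 := p 0 in
  let p1 := right_deriv0 p 1 in
  (p1 * x * `|x|) / (4 * p0 ^+ 2) * std_normal_pdf x.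

Definition f2 (R : realType) (p : R -> R) (x : R) : R :=
  let p0 := p 0 in
  let p1 := right_deriv0 p 1 in
  let p2 := right_deriv0 p 2 in
  x / 4 * (3 + x ^+ 2 + (p2 * x ^+ 2) / (6 * p0 ^+ 3)
           - (p1 ^+ 2 * x ^+ 4) / (8 * p0 ^+ 4)) * std_normal_pdf x.

Definition mstar (m : nat) : nat := (2 * m./2)%N.

(* Main.v *)
Require Import Defs.
From HB Require Import structures.
From mathcomp Require Import ring lra zify measurable_realfun.
Set Implicit Arguments.
Unset Strict Implicit.
Unset Printing Implicit Defensive.
Local Open Scope classical_set_scope.
Local Open Scope ring_scope.

(** Measure the sample median M on the scale u = 2 F(M - theta) - 1, where F is
    the distribution function of p.  For an odd sample size 2n + 1 the order
    statistics are those of uniform variables transported by F, so u has density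
    proportional to (1 - u^2)^n on [-1, 1], whatever p is.  With s^2 = 2n and
    z = s u this density is close to the normal one: (1 - z^2/s^2)^n equals
    exp(- z^2/2) (1 - z^4/(4 s^2)) up to O(s^-4) times an integrable function
    ([onem_pow_exp]).  Integrating, the distribution function of z is
      Phi z + (3 z + z^3) phi z / (4 s^2) + O(s^-3)
    ([odd_median_cdf_gauss]).  The normalising constant is read off from the total
    mass, that is from the value 1 of the distribution function at z = s.

    All dependence on p is in the substitution z = s (2 F(y) - 1) at
    y = x / (2 p_0 s).  The derivatives of p at 0+ give
    F(y) = 1/2 + p_0 y + p_1 y^2/2 + p_2 y^3/6 + O(y^4) for y >= 0
    ([local_cdf]), hence z = x + a x^2/s + b x^3/s^2 + O(x^4/s^3).  Expanding
    Phi at x to third order then produces exactly f1 / s + f2 / s^2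
    ([substitution_near]); when x exceeds a fixed multiple of s every term is a
    normal tail of order s^-3 ([substitution_far]).  Negative x follow by
    symmetry ([odd_median_expansion]).

    For an even sample size 2j let U <= V be the two middle order statistics,
    and fix y.  The event (U + V)/2 <= y consists of V <= y, and of the event that
    exactly j observations lie below y while the nearest observation above y is
    closer to y than the nearest one below.  If this race between the two nearest
    neighbours were won from above with conditional probability exactly F(y),
    Pascal's rule would turn the total probability into the one for sample size
    2j + 1 ([median_even_law]).  The true winning rate at distance t from y
    differs from F(y) by O(t) as p is Lipschitz near 0, the race is decided at
    distances of order 1/j, and exactly j observations lie below y with
    probability O(j^(-1/2)); so the error is O(j^(-3/2)) ([race_bound]).

    Each of these estimates is obtained by comparing two functions through their
    derivatives ([drv_bound]). *)

(** * Comparing functions through their derivatives *)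
Section calculus.
Context (R : realType).
Implicit Types (f g : R -> R) (x a b c : R).

Lemma drv_cst c x : is_derive x 1 (fun _ : R => c) 0.
Proof. exact: is_derive_cst. Qed.

Lemma drv_id x : is_derive x 1 (fun t : R => t) 1.
Proof. exact: is_derive_id. Qed.

Lemma drvD f g x a b : is_derive x 1 f a -> is_derive x 1 g b ->
  is_derive x 1 (fun t => f t + g t) (a + b).
Proof. exact: is_deriveD. Qed.

Lemma drvN f x a : is_derive x 1 f a -> is_derive x 1 (fun t => - f t) (- a).
Proof. exact: is_deriveN. Qed.

Lemma drvB f g x a b : is_derive x 1 f a -> is_derive x 1 g b ->
  is_derive x 1 (fun t => f t - g t) (a - b).
Proof. exact: is_deriveB. Qed.

Lemma drvM f g x a b : is_derive x 1 f a -> is_derive x 1 g b ->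
  is_derive x 1 (fun t => f t * g t) (a * g x + f x * b).
Proof.
move=> hf hg; apply: (is_derive_eq (is_deriveM hf hg)).
by rewrite addrC /GRing.scale /= (mulrC (g x)).
Qed.

Lemma drvZ c f x a : is_derive x 1 f a ->
  is_derive x 1 (fun t => c * f t) (c * a).
Proof. by move=> hf; apply: (is_derive_eq (drvM (drv_cst c x) hf)); ring. Qed.

Lemma drvX n f x a : is_derive x 1 f a ->
  is_derive x 1 (fun t => f t ^+ n) (n%:R * f x ^+ n.-1 * a).
Proof.
move=> hf; elim: n => [|n ih].
  by apply: (is_derive_eq (drv_cst 1 x)); rewrite !mul0r.
have -> : (fun t => f t ^+ n.+1) = (fun t => f t * f t ^+ n).
  by apply/funext => t; rewrite exprS.
apply: (is_derive_eq (drvM hf ih)) => /=.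
case: n {ih} => [|n] /=; first by rewrite expr0; ring.
rewrite -(natr1 n.+1) exprS; ring.
Qed.

Lemma drv_comp f g x a b : is_derive x 1 g b -> is_derive (g x) 1 f a ->
  is_derive x 1 (fun t => f (g t)) (a * b).
Proof.
move=> hg hf.
exact: is_derive1_comp.
Qed.

Lemma drv_exp f x a : is_derive x 1 f a ->
  is_derive x 1 (fun t => expR (f t)) (expR (f x) * a).
Proof. by move=> hf; apply: drv_comp. Qed.

Lemma drvV f x a : f x != 0 -> is_derive x 1 f a ->
  is_derive x 1 (fun t => (f t)^-1) (- (a / f x ^+ 2)).
Proof.
move=> fx hf; apply: (is_derive_eq (is_deriveV fx hf)).
by rewrite /GRing.scale/= mulNr mulrC.
Qed.

Lemma drv_cont f x a : is_derive x 1 f a -> {for x, continuous f}.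
Proof.
by move=> [df _]; apply: differentiable_continuous; apply/derivable1_diffP.
Qed.

(** This is the form in which all error terms below are integrated: the mean value
    theorem is applied to g - f and to g + f, whose derivatives are nonnegative. *)
Lemma drv_bound_oo (f g df dg : R -> R) a b : a <= b ->
  (forall x, a < x < b -> is_derive x 1 f (df x)) ->
  (forall x, a < x < b -> is_derive x 1 g (dg x)) ->
  {within `[a, b], continuous f} -> {within `[a, b], continuous g} ->
  (forall x, a < x < b -> `|df x| <= dg x) ->
  `|f b - f a| <= g b - g a.
Proof.
rewrite le_eqVlt => /predU1P[->|ab] hf hg cf cg hb.
  by rewrite !subrr normr0.
have L (s : R) : s ^+ 2 = 1 -> 0 <= (g b - s * f b) - (g a - s * f a).
  move=> s1.
  have [||c cab ->] := @MVT R (fun t => g t - s * f t)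
    (fun t => dg t - s * df t) a b ab.
  - move=> x; rewrite in_itv/= => xab.
    by apply: drvB; [exact: hg|apply: drvZ; exact: hf].
  - move=> x; apply: cvgB; first exact: cg.
    by apply: cvgM; [exact: cvg_cst|exact: cf].
  - rewrite mulr_ge0//; last by rewrite subr_ge0 ltW.
    rewrite subr_ge0.
    have hc : `|df c| <= dg c by apply: hb; rewrite in_itv/= in cab.
    apply: le_trans hc.
    have /eqP := s1; rewrite sqrf_eq1 => /orP[]/eqP->.
    + by rewrite mul1r ler_norm.
    + by rewrite mulN1r -normrN ler_norm.
have := L 1 (expr1n _ _); have := L (-1); rewrite sqrrN expr1n => /(_ erefl).
by rewrite ler_norml; lra.
Qed.

Lemma drv_bound (f g df dg : R -> R) a b : a <= b ->
  (forall x, a <= x <= b -> is_derive x 1 f (df x)) ->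
  (forall x, a <= x <= b -> is_derive x 1 g (dg x)) ->
  (forall x, a <= x <= b -> `|df x| <= dg x) ->
  `|f b - f a| <= g b - g a.
Proof.
move=> ab hf hg hb.
have oo x : a < x < b -> a <= x <= b by move=> /andP[/ltW-> /ltW->].
apply: (@drv_bound_oo f g df dg) => // [x /oo|x /oo|||x /oo]; auto.
- apply: continuous_in_subspaceT => x; rewrite inE/= in_itv/= => xab.
  exact: drv_cont (hf x xab).
- apply: continuous_in_subspaceT => x; rewrite inE/= in_itv/= => xab.
  exact: drv_cont (hg x xab).
Qed.

Lemma drv_le (g dg : R -> R) a b : a <= b ->
  (forall x, a <= x <= b -> is_derive x 1 g (dg x)) ->
  (forall x, a <= x <= b -> 0 <= dg x) -> g a <= g b.
Proof.
move=> ab hg hb; rewrite -subr_ge0.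
have hc x : a <= x <= b -> is_derive x 1 (fun _ : R => 0 : R) 0.
  by move=> _; exact: drv_cst.
have hd x : a <= x <= b -> `|0 : R| <= dg x by move=> xab; rewrite normr0 hb.
by apply: le_trans (drv_bound ab hc hg hd); rewrite normr_ge0.
Qed.

End calculus.

Section expo.
Context (R : realType).

(** Only the existence of a bound matters: each Gaussian factor is used to
    absorb some power of its argument. *)
Lemma pow_gauss_bounded n (c : R) : 0 < c ->
  exists2 K : R, 0 < K & forall x, 0 <= x -> x ^+ n * expR (- (c * x ^+ 2)) <= K.
Proof.
move=> c0; exists (1 + n`!%:R / c ^+ n).
  by rewrite addr_gt0// divr_gt0 ?exprn_gt0// ltr0n fact_gt0.
move=> x x0; set y := c * x ^+ 2.
have y0 : 0 <= y by rewrite mulr_ge0 ?exprn_ge0// ltW.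
have ey : expR (- y) <= 1 by rewrite -expR0 ler_expR oppr_le0.
have [x1|x1] := leP x 1.
  rewrite (@le_trans _ _ 1)//; last first.
    by rewrite lerDl divr_ge0 ?exprn_ge0 ?ler0n ?ltW.
  by rewrite -[leRHS]mulr1 ler_pM ?exprn_ge0 ?expR_ge0 ?exprn_ile1.
have h : y ^+ n <= n`!%:R * expR y.
  case: n => [|n]; first by rewrite fact0 expr0 mul1r -expR0 ler_expR.
  have := expR_ge1Dxn n y0 => h.
  rewrite mulrC -ler_pdivrMr ?ltr0n ?fact_gt0//.
  by apply: le_trans h; rewrite lerDr.
apply: (@le_trans _ _ ((y ^+ n * expR (- y)) / c ^+ n)).
  rewrite /y exprMn [c ^+ n * _]mulrC mulrAC mulfK ?gt_eqF ?exprn_gt0//.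
  by rewrite ler_wpM2r ?expR_ge0// -exprM ler_weXn2l ?(ltW x1)// leq_pmull.
rewrite (@le_trans _ _ (n`!%:R / c ^+ n)) ?lerDr//.
rewrite ler_wpM2r ?invr_ge0 ?exprn_ge0 ?(ltW c0)//.
by rewrite expRN ler_pdivrMr ?expR_gt0.
Qed.
End expo.

(** * The distribution function of a density *)
Definition density_cdf (R : realType) (p : R -> R) (y : R) : R :=
  Rintegral lebesgue_measure `]-oo, y] p.

Section density_cdf.
Context (R : realType) (p : R -> R).
Hypothesis hp : is_density p.
Notation mu := (@lebesgue_measure R).

Lemma density_integrable (A : set R) : measurable A ->
  mu.-integrable A (EFin \o p).
Proof.
move=> mA; case: hp => mp p0 ip.
apply: (@integrableS _ _ _ mu setT) => //.
apply/integrableP; split; first exact/measurable_EFinP.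
under eq_integral => x _ do rewrite /= ger0_norm//.
by rewrite ip ltry.
Qed.

Lemma density_integral_fin (A : set R) : measurable A ->
  (\int[mu]_(x in A) (p x)%:E)%E \is a fin_num.
Proof. by move=> mA; apply: integrable_fin_num => //; exact: density_integrable. Qed.

Lemma density_cdfE y : (\int[mu]_(x in `]-oo, y]) (p x)%:E)%E = (density_cdf p y)%:E.
Proof. by rewrite /density_cdf /Rintegral fineK// density_integral_fin. Qed.

Lemma density_cdf_compl y : (\int[mu]_(x in `]y, +oo[) (p x)%:E)%E = (1 - density_cdf p y)%:E.
Proof.
case: (hp) => mp p0 ip.
have UT : `]-oo, y] `|` `]y, +oo[ = [set: R].
  by rewrite -setCitvl setUv.
have := ip; rewrite -UT.
rewrite ge0_integral_setU//=.
- rewrite density_cdfE; case: (integral _ _ _) => [r| |]//= [<-].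
  by rewrite addrAC subrr add0r.
- by rewrite UT; exact/measurable_EFinP.
- by move=> x _; rewrite lee_fin.
- by apply/disj_setPS => x []; rewrite /= !in_itv/= andbT => /le_lt_trans /[apply]; rewrite ltxx.
Qed.

Lemma density_cdf_ge0 y : 0 <= density_cdf p y.
Proof. by case: hp => _ p0 _; apply: Rintegral_ge0. Qed.

Lemma density_cdf_le1 y : density_cdf p y <= 1.
Proof.
case: (hp) => _ p0 _.
have : (0 <= \int[mu]_(x in `]y, +oo[) (p x)%:E)%E.
  by apply: integral_ge0 => x _; rewrite lee_fin.
by rewrite density_cdf_compl lee_fin subr_ge0.
Qed.

Lemma density_cdf_nd : {homo density_cdf p : x y / x <= y}.
Proof.
move=> x y xy; case: (hp) => mp p0 _; rewrite -lee_fin -!density_cdfE.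
apply: ge0_subset_integral => //.
- by apply/measurable_EFinP; exact: measurable_funTS.
- by move=> t _; rewrite lee_fin.
- by apply: subset_itvl; rewrite bnd_simp.
Qed.

Lemma density_cdf_is_derive y : {for y, continuous p} -> is_derive y 1 (density_cdf p) (p y).
Proof.
move=> cp.
have [] := @continuous_FTC1 R p -oo%O y (y + 1).
- by rewrite ltrDl.
- exact: density_integrable.
- by rewrite ltNyr.
- exact: cp.
by rewrite derive1E => h1 h2; exact: DeriveDef h1 h2.
Qed.

(** Reflection preserves Lebesgue measure, so the mass to the left of - y is that
    to the right of y. *)
Lemma density_cdf_sym y : (forall x, p (- x) = p x) -> density_cdf p (- y) = 1 - density_cdf p y.
Proof.
move=> sp; case: (hp) => mp p0 _; apply: EFin_inj.
rewrite -density_cdfE -density_cdf_compl.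
rewrite (_ : `]-oo, - y]%classic =
    (-%R : measurableTypeR R -> measurableTypeR R) @^-1` `[y, +oo[); last first.
  by rewrite opp_preimage_itvbndy.
under eq_integral => x _ do rewrite -sp.
rewrite -(@ge0_integral_pushforward _ _ _ _ _ (-%R : measurableTypeR R -> measurableTypeR R) _ mu `[y, +oo[ (EFin \o p))//=.
- rewrite [RHS]integral_itv_obnd_cbnd; last first.
    by apply/measurable_EFinP; exact: measurable_funTS.
  by apply: eq_measure_integral => //= A mA AS; exact: lebesgue_measureN.
- by apply/measurable_EFinP; exact: measurable_funTS.
- by move=> x _; rewrite lee_fin.
Qed.

(** By uniqueness of Lebesgue measure it is enough to compare half-open
    intervals. *)
Lemma lebesgue_measure_shift (th : R) (A : set R) : measurable A ->
  pushforward mu (center th : measurableTypeR R -> measurableTypeR R) A = mu A.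
Proof.
move=> mA; apply/esym/lebesgue_measure_unique => //=.
  exact: measurable_funB.
move=> mf _ [[a b]] _ <-.
rewrite /pushforward/=.
have -> : center th @^-1` `]a, b] = `](a + th), (b + th)]%classic.
  by apply/seteqP; split => x /=; rewrite !in_itv/= ltrBrDr lerBlDr.
rewrite !lebesgue_measure_itv/= !lte_fin ltrD2r.
by case: ifP => // _; rewrite -!EFinB opprD addrACA subrr addr0.
Qed.

Lemma density_cdf_shift (th y : R) :
  (\int[mu]_(x in `]-oo, y]) (p (x - th))%:E)%E = (density_cdf p (y - th))%:E.
Proof.
case: (hp) => mp p0 _; rewrite -density_cdfE.
rewrite (_ : `]-oo, y]%classic =
    (center th : measurableTypeR R -> measurableTypeR R) @^-1` `]-oo, (y - th)]); last first.
  by apply/seteqP; split => x /=; rewrite !in_itv/= lerD2r.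
rewrite -(@ge0_integral_pushforward _ _ _ _ _ (center th : measurableTypeR R -> measurableTypeR R) _ mu _ (EFin \o p))//=.
- apply: eq_measure_integral => //=; first exact: measurable_funB.
  by move=> mf A mA AS; exact: lebesgue_measure_shift.
- exact: measurable_funB.
- by apply/measurable_EFinP; exact: measurable_funTS.
- by move=> x _; rewrite lee_fin.
Qed.
End density_cdf.

(** * The standard normal law *)
Section gauss.
Context (R : realType).
Notation phi := (@std_normal_pdf R).
Notation Phi := (@std_normal_cdf R).
Implicit Types x y : R.

Definition gauss_peak : R := normal_peak 1.

Lemma gauss_peak_gt0 : 0 < gauss_peak.
Proof. by rewrite normal_peak_gt0// oner_neq0. Qed.

Lemma phiE x : phi x = gauss_peak * expR (- (2^-1 * x ^+ 2)).
Proof.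
rewrite /std_normal_pdf normal_pdfE ?oner_neq0// /normal_fun.
by congr (_ * expR _); rewrite subr0 expr1n; field.
Qed.

Lemma phi_density : is_density phi.
Proof.
split.
- exact: measurable_normal_pdf.
- by move=> x; rewrite phiE mulr_ge0 ?expR_ge0 ?ltW ?gauss_peak_gt0.
- exact: integral_normal_pdf.
Qed.

Lemma PhiE x : Phi x = density_cdf phi x.
Proof. by []. Qed.

Lemma phiN x : phi (- x) = phi x.
Proof. by rewrite !phiE sqrrN. Qed.

Lemma phi_ge0 x : 0 <= phi x. Proof. by case: phi_density. Qed.

Lemma Phi_ge0 x : 0 <= Phi x. Proof. exact: density_cdf_ge0 phi_density _. Qed.
Lemma Phi_le1 x : Phi x <= 1. Proof. exact: density_cdf_le1 phi_density _. Qed.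
Lemma PhiN x : Phi (- x) = 1 - Phi x.
Proof. exact: density_cdf_sym phi_density _ phiN. Qed.
Lemma Phi0 : Phi 0 = 2^-1.
Proof. by have := PhiN 0; rewrite oppr0; lra. Qed.

Lemma phi_drv x : is_derive x 1 phi (- x * phi x).
Proof.
have -> : phi = (fun t => gauss_peak * expR (- (2^-1 * t ^+ 2))).
  by apply/funext => t; rewrite phiE.
apply: (is_derive_eq (drvZ _ (drv_exp (drvN (drvZ _ (drvX 2 (drv_id x))))))).
by rewrite /=; field.
Qed.

Lemma Phi_drv x : is_derive x 1 Phi (phi x).
Proof. exact: (density_cdf_is_derive phi_density (drv_cont (phi_drv x))). Qed.

Lemma Phi_lim1 x L : (forall y, x <= y -> Phi y <= L) -> 1 <= L.
Proof.
move=> h.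
pose idTR : measurableTypeR R -> R := idfun.
pose m := @isMeasurableFun.Build _ _ _ _ idTR (@measurable_id _ _ setT).
pose X : {RV (normal_prob 0 1) >-> R} := HB.pack idTR m.
have := @cvg_cdfy1 _ _ R (normal_prob 0 1) X.
move=> /cvge_to_le - /(_ L%:E); rewrite lee_fin; apply.
exists x; split; first exact: num_real.
move=> y /ltW /h.
rewrite -lee_fin PhiE -(density_cdfE phi_density).
by apply: le_trans.
Qed.

Lemma phi_pow_bounded n : exists2 K : R, 0 < K & forall x, 0 <= x -> x ^+ n * phi x <= K.
Proof.
have [|K K0 h] := @pow_gauss_bounded R n 2^-1; first by rewrite invr_gt0.
exists (gauss_peak * K); first by rewrite mulr_gt0// gauss_peak_gt0.
by move=> x x0; rewrite phiE mulrCA ler_wpM2l ?h// ltW// gauss_peak_gt0.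
Qed.

(** The power 3 is what an error of order s^-3 asks for; since x^4 phi x is bounded,
    Phi x + K / x^3 is nonincreasing, and it tends to 1. *)
Lemma Phi_tail : exists2 K : R, 0 < K & forall x, 0 < x -> 1 - Phi x <= K / x ^+ 3.
Proof.
have [K K0 hK] := phi_pow_bounded 4.
exists K => // x x0.
suff : 1 <= Phi x + K / x ^+ 3 by lra.
apply: (@Phi_lim1 x) => y xy.
have h := @drv_bound R Phi (fun t => - (K * t ^- 3)) phi (fun t => 3 * K / t ^+ 4) x y xy.
have : `|Phi y - Phi x| <= - (K * y ^- 3) - - (K * x ^- 3).
  apply: h => t /andP[xt _].
  - exact: Phi_drv.
  - have t0 : t != 0 by rewrite gt_eqF// (lt_le_trans x0).
    apply: (is_derive_eq (drvN (drvZ K (drvV _ (drvX 3 (drv_id t)))))).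
      by rewrite expf_neq0.
    by rewrite /=; field.
  - have t0 : 0 < t := lt_le_trans x0 xt.
    rewrite ger0_norm ?phi_ge0// ler_pdivlMr ?exprn_gt0// mulrC.
    by rewrite (le_trans (hK _ (ltW t0)))//; lra.
have : 0 <= K * y ^- 3.
  by rewrite mulr_ge0 ?invr_ge0 ?exprn_ge0 ?ltW// (lt_le_trans x0).
by have := ler_norm (Phi y - Phi x); lra.
Qed.

End gauss.

(** * Binomial tails and the law of an odd median *)
Section binom_tail.
Context (R : realType).
Implicit Types (q u : R).

Definition binom_mass (N k : nat) q : R := 'C(N, k)%:R * q ^+ k * (1 - q) ^+ (N - k).

Definition binom_tail (N i : nat) q : R := \sum_(k < N.+1 | (i <= k)%N) binom_mass N k q.

Lemma binom_tail0 N q : binom_tail N 0 q = 1.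
Proof.
rewrite /binom_tail; have := exprDn (1 - q) q N.
rewrite subrK expr1n => ->; apply: eq_bigr => k _.
by rewrite /binom_mass -mulr_natr; ring.
Qed.

Lemma binom_tail_gt N i q : (N < i)%N -> binom_tail N i q = 0.
Proof.
move=> Ni; rewrite /binom_tail big_pred0// => k.
by apply/negbTE; rewrite -ltnNge; apply: leq_trans Ni; rewrite ltnS -ltnS.
Qed.

Lemma binom_tailS N i q : binom_tail N i q = binom_mass N i q + binom_tail N i.+1 q.
Proof.
have [iN|Ni] := leqP i N; last first.
  by rewrite !binom_tail_gt ?(ltnW Ni)// 1?ltnW// /binom_mass bin_small// !mul0r add0r.
rewrite {1}/binom_tail (bigD1 (Ordinal (iN : (i < N.+1)%N)))//=; congr (_ + _).
rewrite /binom_tail; apply: eq_bigl => k.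
by rewrite ltn_neqAle andbC eq_sym.
Qed.

(** Conditioning on one of the N + 1 trials. *)
Lemma binom_tail_rec N i q :
  binom_tail N.+1 i.+1 q = (1 - q) * binom_tail N i.+1 q + q * binom_tail N i q.
Proof.
rewrite /binom_tail big_mkcond big_ord_recl /= add0r.
rewrite [X in (1 - q) * X]big_mkcond [X in q * X]big_mkcond/=.
rewrite [X in (1 - q) * X]big_ord_recl /= add0r !mulr_sumr.
rewrite big_ord_recr/= [X in _ = _ + X]big_ord_recr/= addrA -big_split/=.
congr (_ + _).
- apply: eq_bigr => k _; rewrite /bump /= !add1n ltnS.
  case: ifP => // _; last by rewrite !mulr0 addr0.
  rewrite /binom_mass binS natrD !subSS.
  have -> : (N - k = (N - k.+1).+1)%N by rewrite subnSK.
  by rewrite !exprS; ring.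
- rewrite /bump /= !add1n ltnS; case: ifP => _; last by rewrite mulr0.
  by rewrite /binom_mass !binn !subnn exprS; ring.
Qed.

Lemma binom_tail_at0 N i : binom_tail N i.+1 0 = 0.
Proof.
elim: N => [|N ih]; first by rewrite binom_tail_gt.
by rewrite binom_tail_rec ih mulr0 mul0r addr0.
Qed.

Lemma binom_tail_at1 N i : (i <= N)%N -> binom_tail N i 1 = 1.
Proof.
elim: N i => [|N ih] [|i] // iN; rewrite ?binom_tail0//.
by rewrite binom_tail_rec subrr mul0r add0r mul1r ih.
Qed.

(** The density of the order statistic of rank i + 1 among N + 1 uniform variables.
    In the induction the two tails produced by differentiating the weights in
    [binom_tail_rec] differ by a single binomial term. *)
Lemma binom_tail_drv N i q : is_derive q 1 (binom_tail N.+1 i.+1)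
  (N.+1%:R * binom_mass N i q).
Proof.
elim: N i => [|N ih] i.
  have -> : binom_tail 1 i.+1 = (fun t => t * binom_tail 0 i 0).
    apply/funext => t; rewrite binom_tail_rec binom_tail_gt// mulr0 add0r.
    by case: i => [|i]; rewrite ?binom_tail0// !binom_tail_gt.
  apply: (is_derive_eq (drvM (drv_id _) (drv_cst _ _))).
  rewrite mulr0 addr0 !mul1r; case: i => [|i].
    by rewrite binom_tail0 /binom_mass bin0 !mulr1.
  by rewrite binom_tail_gt// /binom_mass bin0n !mul0r.
have -> : binom_tail N.+2 i.+1 =
    (fun t => (1 - t) * binom_tail N.+1 i.+1 t + t * binom_tail N.+1 i t).
  by apply/funext => t; rewrite binom_tail_rec.
case: i => [|i].
  have -> : binom_tail N.+1 0 = fun _ => 1 by apply/funext => t; rewrite binom_tail0.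
  apply: (is_derive_eq (drvD (drvM (drvB (drv_cst 1 q) (drv_id q)) (ih 0%N))
     (drvM (drv_id q) (drv_cst 1 q)))).
  have := binom_tailS N.+1 0 q; rewrite binom_tail0 => h.
  have {h}-> : binom_tail N.+1 1 q = 1 - binom_mass N.+1 0 q by rewrite h addrAC subrr add0r.
  rewrite /binom_mass !bin0 !subn0 -(natr1 N.+1) !exprS; ring.
apply: (is_derive_eq (drvD (drvM (drvB (drv_cst 1 q) (drv_id q)) (ih i.+1))
     (drvM (drv_id q) (ih i)))).
rewrite (binom_tailS N.+1 i.+1) /binom_mass binS natrD subSS -(natr1 N.+1).
have [iN|Ni] := leqP i.+1 N; last by rewrite (bin_small Ni) exprS; ring.
have -> : (N - i = (N - i.+1).+1)%N by rewrite subnSK.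
rewrite !exprS; ring.
Qed.

(** The median of 2n + 1 uniform variables is symmetric about 1/2: the derivative
    is invariant under q -> 1 - q, so the sum of both tails is constant. *)
Lemma binom_tail_sym n q : binom_tail n.*2.+1 n.+1 (1 - q) = 1 - binom_tail n.*2.+1 n.+1 q.
Proof.
pose g t := binom_tail n.*2.+1 n.+1 t + binom_tail n.*2.+1 n.+1 (1 - t).
have dg (t : R) : is_derive t 1 g 0.
  have d1 : is_derive t 1 (fun s : R => 1 - s) (0 - 1).
    exact: drvB (drv_cst _ _) (drv_id _).
  apply: (is_derive_eq (drvD (binom_tail_drv _ _ _) (drv_comp d1 (binom_tail_drv _ _ _)))).
  by rewrite /binom_mass -addnn addnK subKr; ring.
have := is_derive_0_is_cst q 0 dg.
rewrite /g subr0 binom_tail_at0 binom_tail_at1 ?add0r; last by rewrite ltnS -addnn leq_addr.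
by move=> h; apply/eqP; rewrite eq_sym subr_eq addrC h.
Qed.

(** The probability of n successes in 2n fair trials. *)
Definition central_binom (n : nat) : R := 'C(n.*2, n)%:R / 4 ^+ n.

Lemma central_binom_gt0 n : 0 < central_binom n.
Proof.
by rewrite divr_gt0 ?exprn_gt0// ltr0n bin_gt0 -addnn leq_addr.
Qed.

Lemma central_binomS n : central_binom n.+1 = central_binom n * (n.*2.+1%:R / n.*2.+2%:R).
Proof.
have h : ('C(n.+1.*2, n.+1) * n.+1 = 'C(n.*2, n) * (n.*2.+1).*2)%N.
  have e1 : ('C(n.+1.*2, n.+1) * (n.+1`! * n.+1`!) = n.+1.*2`!)%N.
    have := @bin_fact n.+1.*2 n.+1; rewrite -addnn leq_addr addnK => /(_ isT).
    by rewrite mulnA.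
  have e2 : ('C(n.*2, n) * (n`! * n`!) = n.*2`!)%N.
    have := @bin_fact n.*2 n; rewrite -addnn leq_addr addnK => /(_ isT).
    by rewrite mulnA.
  have f0 := fact_gt0 n.
  rewrite doubleS !factS -e2 in e1.
  apply/eqP; rewrite -(eqn_pmul2r (_ : 0 < n.+1 * (n`! * n`!))%N) ; last by rewrite !muln_gt0 f0.
  apply/eqP; rewrite (_ : (_ * n.+1 * _ = 'C(n.+1.*2, n.+1) * (n.+1 * n`! * (n.+1 * n`!)))%N); last by ring.
  rewrite e1 -!muln2; ring.
have : ('C(n.+1.*2, n.+1)%:R * n.+1%:R = 'C(n.*2, n)%:R * (n.*2.+1%:R * 2) :> R).
  by rewrite -!natrM h muln2.
have n0 : n.+1%:R != 0 :> R by rewrite pnatr_eq0.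
move=> /(canRL (mulfK n0)); rewrite /central_binom => ->.
rewrite exprS -[n.*2.+2]doubleS -(muln2 n.+1) natrM.
by field; rewrite expf_neq0//= nat1r n0.
Qed.

(** The recursion multiplies the left-hand side by
    (2n + 1) (2n + 3) / (2n + 2)^2, which is less than 1. *)
Lemma central_binom_sqr n : central_binom n ^+ 2 * n.*2.+1%:R <= 1.
Proof.
elim: n => [|n ih]; first by rewrite /central_binom bin0 expr0 divr1 expr1n mulr1.
apply: le_trans ih; rewrite central_binomS exprMn -mulrA ler_wpM2l ?sqr_ge0//.
rewrite doubleS -[n.*2]muln2 -!(natr1) natrM.
have := ler0n R n; move: (n%:R) => x x0.
rewrite expr_div_n mulrAC ler_pdivrMr; last by rewrite exprn_gt0//; lra.
by nra.
Qed.

(** The distribution function of 2 U - 1, where U is the median of 2n + 1 independent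
    uniform variables on [0, 1]. *)
Definition odd_median_cdf (n : nat) (u : R) : R := binom_tail n.*2.+1 n.+1 ((1 + u) / 2).

Lemma odd_median_cdf_drv n u : is_derive u 1 (odd_median_cdf n)
  (n.*2.+1%:R * central_binom n / 2 * (1 - u ^+ 2) ^+ n).
Proof.
have d1 : is_derive u 1 (fun u : R => (1 + u) / 2) ((0 + 1) / 2 + (1 + u) * 0).
  exact: drvM (drvD (drv_cst _ _) (drv_id _)) (drv_cst _ _).
apply: (is_derive_eq (drv_comp d1 (binom_tail_drv _ _ _))).
rewrite /binom_mass /central_binom -addnn addnK.
have -> : 1 - u ^+ 2 = 4 * ((1 + u) / 2 * (1 - (1 + u) / 2)) by field.
rewrite !exprMn; field.
by rewrite expf_neq0.
Qed.

Lemma odd_median_cdf1 n : odd_median_cdf n 1 = 1.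
Proof.
by rewrite /odd_median_cdf (_ : (1 + 1) / 2 = 1); [apply: binom_tail_at1; rewrite ltnS -addnn leq_addr|field].
Qed.

Lemma odd_median_cdfN n u : odd_median_cdf n (- u) = 1 - odd_median_cdf n u.
Proof. by rewrite /odd_median_cdf -binom_tail_sym; congr binom_tail; field. Qed.

Lemma odd_median_cdf0 n : odd_median_cdf n 0 = 2^-1.
Proof. by have := odd_median_cdfN n 0; rewrite oppr0; lra. Qed.

End binom_tail.

(** * Normal approximation of the odd median *)
Section power_exp.
Context (R : realType).
Implicit Types r v : R.

Lemma onem_exp_ub r : 0 <= r -> r <= 1 -> (1 - r) * expR (r + 2^-1 * r ^+ 2) <= 1.
Proof.
move=> r0 r1.
pose g (t : R) : R := - ((1 - t) * expR (t + 2^-1 * t ^+ 2)).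
have dg (t : R) : is_derive t 1 g (t ^+ 2 * expR (t + 2^-1 * t ^+ 2)).
  apply: (is_derive_eq (drvN (drvM (drvB (drv_cst 1 t) (drv_id t))
    (drv_exp (drvD (drv_id t) (drvZ _ (drvX 2 (drv_id t)))))))).
  by rewrite /=; field.
have := @drv_le R g _ 0 r r0 (fun t _ => dg t).
rewrite /g !(mulr0, expr0n, addr0, subr0, expR0, mulr1)/= lerN2; apply.
by move=> t _; rewrite mulr_ge0 ?expR_ge0 ?sqr_ge0.
Qed.

Lemma onem_exp_lb r : 0 <= r -> r <= 2^-1 ->
  1 <= (1 - r) * expR (r + 2^-1 * r ^+ 2 + r ^+ 3).
Proof.
move=> r0 r1.
pose g (t : R) : R := (1 - t) * expR (t + 2^-1 * t ^+ 2 + t ^+ 3).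
have dg (t : R) : is_derive t 1 g
    (t ^+ 2 * (2 - 3 * t) * expR (t + 2^-1 * t ^+ 2 + t ^+ 3)).
  apply: (is_derive_eq (drvM (drvB (drv_cst 1 t) (drv_id t))
    (drv_exp (drvD (drvD (drv_id t) (drvZ _ (drvX 2 (drv_id t))))
       (drvX 3 (drv_id t)))))).
  by rewrite /=; field.
have := @drv_le R g _ 0 r r0 (fun t _ => dg t).
rewrite /g !(mulr0, expr0n, addr0, subr0, expR0, mulr1)/=; apply.
move=> t /andP[t0 tr]; rewrite !mulr_ge0 ?expR_ge0 ?sqr_ge0//; lra.
Qed.

Lemma expN_ub v : 0 <= v -> expR (- v) <= 1 - v + v ^+ 2.
Proof.
move=> v0; rewrite expRN -[leLHS]mul1r ler_pdivrMr ?expR_gt0//.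
apply: (@le_trans _ _ ((1 - v + v ^+ 2) * (1 + v))).
  have -> : (1 - v + v ^+ 2) * (1 + v) = 1 + v ^+ 3 by ring.
  by rewrite lerDl exprn_ge0.
by rewrite ler_wpM2l ?expR_ge1Dx//; nra.
Qed.

(** With v = n r^2/2, the logarithm of the product lies between - v - n r^3 and - v
    when r <= 1/2.  For r > 1/2 the lower estimate is trivial because
    8 n r^3 > 1. *)
Lemma onem_pow_exp n r : (0 < n)%N -> 0 <= r -> r <= 1 ->
  `|(1 - r) ^+ n * expR (n%:R * r) - (1 - 2^-1 * n%:R * r ^+ 2)|
    <= 8 * n%:R * r ^+ 3 + n%:R ^+ 2 * r ^+ 4.
Proof.
move=> n0 r0 r1.
have N1 : 1 <= n%:R :> R by rewrite ler1n.
set v := 2^-1 * n%:R * r ^+ 2.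
have v0 : 0 <= v by rewrite !mulr_ge0 ?exprn_ge0// invr_ge0.
have x0 : 0 <= (1 - r) ^+ n * expR (n%:R * r).
  by rewrite mulr_ge0 ?expR_ge0 ?exprn_ge0 ?subr_ge0.
have ub : (1 - r) ^+ n * expR (n%:R * r) <= 1 - v + v ^+ 2.
  apply: le_trans (expN_ub v0).
  rewrite expRN -[leRHS]mul1r ler_pdivlMr ?expR_gt0// -mulrA -expRD.
  have -> : n%:R * r + v = n%:R * (r + 2^-1 * r ^+ 2) by rewrite /v; ring.
  rewrite mulrC expRM_natl -exprMn mulrC exprn_ile1 ?onem_exp_ub//.
  by rewrite mulr_ge0 ?expR_ge0 ?subr_ge0.
have nr3 : 0 <= n%:R * r ^+ 3 by rewrite mulr_ge0 ?exprn_ge0.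
have lb : 1 - v - 8 * n%:R * r ^+ 3 <= (1 - r) ^+ n * expR (n%:R * r).
  have [r2|r2] := leP r 2^-1; last first.
    apply: le_trans x0.
    have r3 : 8^-1 <= r ^+ 3.
      have -> : 8^-1 = 2^-1 ^+ 3 :> R by field.
      by rewrite lerXn2r ?nnegrE ?invr_ge0// ltW.
    have : 8^-1 <= n%:R * r ^+ 3.
      by rewrite (le_trans r3)// ler_peMl// exprn_ge0.
    by move: v0; rewrite -mulrA; lra.
  have h : expR (- (v + n%:R * r ^+ 3)) <= (1 - r) ^+ n * expR (n%:R * r).
    rewrite expRN -[leLHS]mul1r ler_pdivrMr ?expR_gt0// -mulrA -expRD.
    have -> : n%:R * r + (v + n%:R * r ^+ 3) =
      n%:R * (r + 2^-1 * r ^+ 2 + r ^+ 3) by rewrite /v; ring.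
    rewrite [X in _ <= X]mulrC expRM_natl -exprMn mulrC exprn_ege1//.
    exact: onem_exp_lb.
  apply: le_trans h; have := expR_ge1Dx (- (v + n%:R * r ^+ 3)).
  by apply: le_trans; rewrite -mulrA; lra.
have v2 : v ^+ 2 <= n%:R ^+ 2 * r ^+ 4.
  have -> : v ^+ 2 = 4^-1 * (n%:R ^+ 2 * r ^+ 4) by rewrite /v; field.
  by rewrite ler_piMl ?mulr_ge0 ?exprn_ge0//; lra.
have nr4 : 0 <= n%:R ^+ 2 * r ^+ 4 by rewrite mulr_ge0 ?exprn_ge0.
move: nr3; rewrite ler_norml; move: lb; rewrite -!mulrA => *; lra.
Qed.

End power_exp.

Section binomial_gauss.
Context (R : realType).
Notation phi := (@std_normal_pdf R).
Notation Phi := (@std_normal_cdf R).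
Notation k0 := (@gauss_peak R).

(** The second term is the antiderivative of (3 - z^4) phi z / (4 s^2). *)
Definition corrected_normal_cdf (s z : R) : R := Phi z + (3 * z + z ^+ 3) * phi z / (4 * s ^+ 2).

(** The antiderivative of phi z (1 - z^4 / (4 s^2)) that vanishes at 0.  It does not
    have total mass 1/2; [corrected_normal_cdf] is its normalised form. *)
Let unscaled_cdf (s z : R) : R :=
  (Phi z - 2^-1) * (1 - 3 / (4 * s ^+ 2)) + (3 * z + z ^+ 3) * phi z / (4 * s ^+ 2).

Lemma unscaled_cdf_drv (s z : R) : s != 0 ->
  is_derive z 1 (unscaled_cdf s) (phi z * (1 - z ^+ 4 / (4 * s ^+ 2))).
Proof.
move=> s0.
apply: (is_derive_eq (drvD
  (drvM (drvB (Phi_drv z) (drv_cst _ _)) (drv_cst _ _))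
  (drvM (drvM (drvD (drvZ 3 (drv_id z)) (drvX 3 (drv_id z))) (phi_drv z)) (drv_cst _ _)))).
by rewrite /=; field.
Qed.

(** The left-hand side is the density at 0 of s (2 U - 1), with U as in
    [odd_median_cdf]. *)
Lemma density_peak_le1 (n : nat) (s : R) : (0 < n)%N -> 0 < s -> s ^+ 2 = n.*2%:R ->
  n.*2.+1%:R * central_binom R n / 2 / s <= 1.
Proof.
move=> n0 s0 sn.
set ka := n.*2.+1%:R * central_binom R n / 2 / s.
have ka0 : 0 <= ka.
  by rewrite !mulr_ge0 ?invr_ge0// ltW// central_binom_gt0.
rewrite -(@ler_pXn2r _ 2) ?nnegrE// expr1n.
have -> : ka ^+ 2 = (central_binom R n ^+ 2 * n.*2.+1%:R) * (n.*2.+1%:R / (4 * s ^+ 2)).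
  by rewrite /ka; field; rewrite gt_eqF.
apply: mulr_ile1; [by rewrite mulr_ge0 ?sqr_ge0| |exact: central_binom_sqr|].
  by rewrite divr_ge0// mulr_ge0 ?sqr_ge0.
rewrite ler_pdivrMr ?mulr_gt0 ?exprn_gt0// mul1r sn -natr1.
have : 1 <= n.*2%:R :> R by rewrite ler1n double_gt0.
by lra.
Qed.

(** The density at z of the rescaled median is its value at 0 times
    (1 - z^2/s^2)^n, so that [onem_pow_exp] at r = z^2/s^2 compares derivatives.  The
    normalising factor is left as it is. *)
Lemma odd_median_cdf_unscaled : exists2 K : R, 0 < K & forall (n : nat) (s z : R),
  (0 < n)%N -> 0 < s -> s ^+ 2 = n.*2%:R -> 0 <= z -> z <= s ->
  `|odd_median_cdf n (z / s) - 2^-1 - n.*2.+1%:R * central_binom R n / 2 / s / k0 * unscaled_cdf s z| <= K / s ^+ 4.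
Proof.
have [c6 c60 h6] := @phi_pow_bounded R 6.
have [c8 c80 h8] := @phi_pow_bounded R 8.
have [c10 c100 h10] := @phi_pow_bounded R 10.
pose K := (8 * c6 + 10 * c8 + 2 * c10) / k0.
have k00 : 0 < k0 := gauss_peak_gt0 R.
have K0 : 0 < K by rewrite divr_gt0//; lra.
exists K => // n s z n0 s0 sn z0 zs.
set ka := n.*2.+1%:R * central_binom R n / 2 / s.
have ka0 : 0 <= ka.
  by rewrite !mulr_ge0 ?invr_ge0// ltW// central_binom_gt0.
have ka1 : ka <= 1 by exact: density_peak_le1.
have sN0 : s != 0 by rewrite gt_eqF.
pose D t := odd_median_cdf n (t / s) - 2^-1 - ka / k0 * unscaled_cdf s t.
pose D' t := ka * ((1 - (t / s) ^+ 2) ^+ n - phi t / k0 * (1 - t ^+ 4 / (4 * s ^+ 2))).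
(* A bounded function whose derivative dominates the polynomial times exp(- t^2/2). *)
pose G (t : R) : R := - (K / s ^+ 4 * (1 + t)^-1).
pose G' (t : R) : R := K / s ^+ 4 * ((1 + t) ^+ 2)^-1.
have dD (t : R) : is_derive t 1 D (D' t).
  have d1 : is_derive t 1 (fun t : R => t / s) (1 / s + t * 0).
    exact: drvM (drv_id _) (drv_cst _ _).
  apply: (is_derive_eq (drvB (drvB (drv_comp d1 (odd_median_cdf_drv _ _)) (drv_cst _ t))
    (drvZ _ (unscaled_cdf_drv t sN0)))).
  by rewrite /D' /ka; field; rewrite sN0 gt_eqF.
have dG (t : R) : 0 <= t -> is_derive t 1 G (G' t).
  move=> t0; have t1 : 1 + t != 0 by rewrite gt_eqF//; lra.
  apply: (is_derive_eq (drvN (drvZ _ (drvV t1 (drvD (drv_cst _ _) (drv_id t)))))).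
  by rewrite /G'; field; rewrite t1 sN0.
have bnd t : 0 <= t -> t <= s -> `|D' t| <= G' t.
  move=> t0 ts; rewrite /D' normrM ger0_norm//.
  apply: (le_trans (ler_wpM2r (normr_ge0 _) ka1)).
  rewrite mul1r.
  have r0 : 0 <= (t / s) ^+ 2 by rewrite sqr_ge0.
  have r1 : (t / s) ^+ 2 <= 1.
    by rewrite exprn_ile1 ?divr_ge0 ?(ltW s0)// ler_pdivrMr ?mul1r.
  have := onem_pow_exp n0 r0 r1.
  have nE : n%:R = s ^+ 2 / 2 by rewrite sn -muln2 natrM mulfK.
  have -> : n%:R * (t / s) ^+ 2 = 2^-1 * t ^+ 2 by rewrite nE; field.
  have -> : 2^-1 * n%:R * (t / s) ^+ 2 ^+ 2 = t ^+ 4 / (4 * s ^+ 2).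
    by rewrite nE; field.
  have -> : 8 * n%:R * (t / s) ^+ 2 ^+ 3 + n%:R ^+ 2 * (t / s) ^+ 2 ^+ 4 =
     (4 * t ^+ 6 + 4^-1 * t ^+ 8) / s ^+ 4 by rewrite nE; field.
  set A := (1 - _) ^+ n; set B := 1 - t ^+ 4 / _ => hAB.
  have -> : phi t / k0 = expR (- (2^-1 * t ^+ 2)).
    by rewrite phiE mulrC mulKf// gt_eqF.
  set e := expR (2^-1 * t ^+ 2) in hAB.
  have e0 : 0 < e by rewrite expR_gt0.
  have eN : expR (- (2^-1 * t ^+ 2)) = e^-1 by rewrite expRN.
  have -> : A - expR (- (2^-1 * t ^+ 2)) * B = (A * e - B) * e^-1.
    by rewrite eN; field; rewrite gt_eqF.
  rewrite normrM [X in _ * X]ger0_norm ?invr_ge0 ?(ltW e0)//.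
  apply: (le_trans (ler_wpM2r _ hAB)); first by rewrite invr_ge0 ltW.
  rewrite /G' /K -eN.
  rewrite ler_pdivlMr ?exprn_gt0//; last by lra.
  have t10 : 0 <= t ^+ 10 by rewrite exprn_ge0.
  have t6 : 0 <= t ^+ 6 by rewrite exprn_ge0.
  have t8 : 0 <= t ^+ 8 by rewrite exprn_ge0.
  have -> : (4 * t ^+ 6 + 4^-1 * t ^+ 8) / s ^+ 4 *
      expR (- (2^-1 * t ^+ 2)) * (1 + t) ^+ 2 =
      ((4 * t ^+ 6 + 4^-1 * t ^+ 8) * (1 + t) ^+ 2 * phi t) / (k0 * s ^+ 4).
    by rewrite phiE; field; rewrite sN0 gt_eqF.
  have -> : (8 * c6 + 10 * c8 + 2 * c10) / k0 / s ^+ 4 =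
      (8 * c6 + 10 * c8 + 2 * c10) / (k0 * s ^+ 4).
    by field; rewrite sN0 gt_eqF.
  rewrite ler_wpM2r ?invr_ge0 ?mulr_ge0 ?(ltW k00) ?exprn_ge0 ?(ltW s0)//.
  apply: (@le_trans _ _ (8 * (t ^+ 6 * phi t) + 10 * (t ^+ 8 * phi t) + 2 * (t ^+ 10 * phi t))).
    rewrite [leRHS](_ : _ = (8 * t ^+ 6 + 10 * t ^+ 8 + 2 * t ^+ 10) * phi t); last by ring.
    rewrite ler_wpM2r ?phi_ge0//.
    apply: (@le_trans _ _ ((4 * t ^+ 6 + 4^-1 * t ^+ 8) * (2 + 2 * t ^+ 2))).
      rewrite ler_wpM2l//; first by lra.
      by have := sqr_ge0 (1 - t); nra.
    have -> : (4 * t ^+ 6 + 4^-1 * t ^+ 8) * (2 + 2 * t ^+ 2) =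
      8 * t ^+ 6 + (8 + 2^-1) * t ^+ 8 + 2^-1 * t ^+ 10 by field.
    by lra.
  by have := h6 _ t0; have := h8 _ t0; have := h10 _ t0; lra.
have := @drv_bound R D G D' G' 0 z z0 (fun t _ => dD t).
have -> : D 0 = 0.
  by rewrite /D /unscaled_cdf mul0r odd_median_cdf0 Phi0 expr0n !(mulr0, addr0, subrr, mul0r) ?subr0.
rewrite subr0; move=> h; apply: le_trans (h _ _) _.
- by move=> t /andP[t0 _]; exact: dG.
- by move=> t /andP[t0 tz]; apply: bnd => //; exact: le_trans zs.
- rewrite /G addr0 invr1 mulr1 opprK [leLHS]addrC lerBlDr lerDl.
  by rewrite mulr_ge0 ?invr_ge0 ?divr_ge0 ?exprn_ge0 ?ltW//; lra.
Qed.

(** At z = s the left-hand side of [odd_median_cdf_unscaled] is known up to the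
    normalising factor lam, as the distribution function is 1 there; this gives
    lam (1 - 3/(4 s^2)) = 1 + O(s^-3). *)
Lemma odd_median_cdf_gauss : exists2 K : R, 0 < K & forall (n : nat) (s z : R),
  (0 < n)%N -> 0 < s -> s ^+ 2 = n.*2%:R -> 0 <= z -> z <= s ->
  `|odd_median_cdf n (z / s) - corrected_normal_cdf s z| <= K / s ^+ 3.
Proof.
have [K K0 hK] := odd_median_cdf_unscaled.
have [K1 K10 hK1] := @Phi_tail R.
have [c1 c10 h1] := @phi_pow_bounded R 1.
have [c3 c30 h3] := @phi_pow_bounded R 3.
have [c4 c40 h4] := @phi_pow_bounded R 4.
pose La : R := k0^-1.
have La0 : 0 < La by rewrite invr_gt0 gauss_peak_gt0.
pose K5 := K + La * (K1 + c4).
have K50 : 0 < K5 by rewrite addr_gt0// mulr_gt0// addr_gt0.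
pose Kg := c1 + c3.
exists (K + K5 + Kg * (2 * K5 + La)).
  by rewrite !addr_gt0// mulr_gt0 ?addr_gt0// mulr_gt0.
move=> n s z n0 s0 sn z0 zs.
set ka := n.*2.+1%:R * central_binom R n / 2 / s.
have ka0 : 0 <= ka.
  by rewrite !mulr_ge0 ?invr_ge0// ltW// central_binom_gt0.
have ka1 : ka <= 1 by exact: density_peak_le1.
have s2 : 2 <= s ^+ 2 by rewrite sn (ler_nat _ 1.*2) leq_double.
have s1 : 1 <= s.
  by rewrite -(@ler_pXn2r _ 2) ?nnegrE ?(ltW s0)// expr1n; lra.
pose i := s^-1.
have i0 : 0 < i by rewrite invr_gt0.
have i1 : i <= 1 by rewrite invf_le1.
pose e := i ^+ 3. pose d := i ^+ 2.
have d0 : 0 < d by rewrite exprn_gt0.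
have e0 : 0 < e by rewrite exprn_gt0.
have ed : e <= d by rewrite ler_wiXn2l ?(ltW i0).
have i4e : i ^+ 4 <= e by rewrite ler_wiXn2l ?(ltW i0).
have d2e : d ^+ 2 <= e by rewrite -exprM ler_wiXn2l ?(ltW i0).
pose lam := ka / k0.
have lam0 : 0 <= lam by rewrite divr_ge0// ltW// gauss_peak_gt0.
have lamLa : lam <= La by rewrite /lam ler_piMl// invr_ge0 ltW// gauss_peak_gt0.
pose c := 3 / (4 * s ^+ 2).
have cE : c = 3 / 4 * d by rewrite /c /d /i; field; rewrite gt_eqF.
pose P := Phi z - 2^-1.
pose g := (3 * z + z ^+ 3) * phi z / (4 * s ^+ 2).
have gE : g = (3 * (z ^+ 1 * phi z) + z ^+ 3 * phi z) / 4 * d.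
  by rewrite /g /d /i; field; rewrite gt_eqF.
have g0 : 0 <= g.
  by rewrite gE mulr_ge0 ?(ltW d0)// divr_ge0// addr_ge0// ?mulr_ge0// ?exprn_ge0// phi_ge0.
have gd : g <= Kg * d.
  rewrite gE ler_wpM2r ?(ltW d0)// /Kg.
  have := h1 _ z0; have := h3 _ z0; lra.
pose gs := (3 * s + s ^+ 3) * phi s / (4 * s ^+ 2).
have gs0 : 0 <= gs.
  by rewrite divr_ge0 ?mulr_ge0 ?addr_ge0 ?mulr_ge0 ?exprn_ge0 ?phi_ge0// ltW//.
have gse : gs <= c4 * e.
  apply: (@le_trans _ _ (s ^+ 4 * phi s * e)); last first.
    by rewrite ler_wpM2r ?(ltW e0)// h4// ltW.
  have -> : s ^+ 4 * phi s * e = (4 * s ^+ 3 * phi s) / (4 * s ^+ 2).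
    by rewrite /e /i; field; rewrite gt_eqF.
  rewrite ler_wpM2r ?invr_ge0 ?mulr_ge0 ?exprn_ge0 ?(ltW s0)// ler_wpM2r ?phi_ge0//.
  have : s * 1 <= s * s ^+ 2 by rewrite ler_wpM2l ?(ltW s0)//; lra.
  by rewrite mulr1 -exprS; lra.
have := hK n s s n0 s0 sn (ltW s0) (lexx s).
rewrite divff; last by rewrite gt_eqF.
rewrite odd_median_cdf1 -/ka -/lam /unscaled_cdf -/c -/gs => hs.
have := hK n s z n0 s0 sn z0 zs.
rewrite -/ka -/lam /unscaled_cdf -/c -/g -/P => hz.
have tl := hK1 _ s0.
have tl0 := Phi_le1 s.
have E4 K' : K' / s ^+ 4 = K' * i ^+ 4 by rewrite /i exprVn.
have E3 K' : K' / s ^+ 3 = K' * e by rewrite /e /i exprVn.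
rewrite E4 in hs; rewrite E4 in hz; rewrite E3 in tl; rewrite E3.
(* Total mass: the value at z = s determines lam. *)
have hA : `|1 - lam * (1 - c)| <= 2 * K5 * e.
  have -> : 1 - lam * (1 - c) = 2 * ((1 - 2^-1 - lam * ((Phi s - 2^-1) * (1 - c) + gs))
     + (lam * (gs - (1 - Phi s) * (1 - c)))) by field.
  rewrite normrM ger0_norm// -mulrA ler_wpM2l// /K5 [leRHS]mulrDl.
  apply: (le_trans (ler_normD _ _)); apply: lerD.
    by apply: (le_trans hs); rewrite ler_wpM2l// ltW.
  rewrite normrM (ger0_norm lam0) -mulrA ler_pM// [leRHS]mulrDl.
  have hh : 0 <= (1 - Phi s) * (1 - c) <= K1 * e.
    have d1 : d <= 1 by rewrite exprn_ile1// ltW.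
    have /andP[c1' c2'] : 0 <= 1 - c <= 1 by rewrite cE; clear -d0 d1; lra.
    apply/andP; split; first by rewrite mulr_ge0// subr_ge0.
    by apply: le_trans tl; rewrite ler_piMr// subr_ge0.
  by rewrite ler_norml; move: hh gs0 gse; clear; lra.
have hB : `|lam - 1| <= (2 * K5 + La) * d.
  have -> : lam - 1 = - (1 - lam * (1 - c)) + lam * c by ring.
  apply: (le_trans (ler_normD _ _)); rewrite normrN [leRHS]mulrDl; apply: lerD.
    by apply: (le_trans hA); rewrite ler_wpM2l// mulr_ge0// ltW.
  rewrite cE ger0_norm; last by rewrite !mulr_ge0// ltW.
  apply: ler_pM => //; first by rewrite !mulr_ge0// ltW.
  by clear -d0; lra.
have -> : odd_median_cdf n (z / s) - corrected_normal_cdf s z =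
  (odd_median_cdf n (z / s) - 2^-1 - lam * (P * (1 - c) + g)) - P * (1 - lam * (1 - c)) + g * (lam - 1).
  by rewrite /corrected_normal_cdf -/g /P; ring.
apply: (le_trans (ler_normD _ _)); rewrite [leRHS]mulrDl; apply: lerD; last first.
  rewrite normrM (ger0_norm g0).
  apply: (@le_trans _ _ ((Kg * d) * ((2 * K5 + La) * d))); first by rewrite ler_pM.
  rewrite (_ : _ * _ = Kg * (2 * K5 + La) * d ^+ 2); last by ring.
  by rewrite ler_wpM2l// mulr_ge0 ?addr_ge0 ?mulr_ge0 ?ltW.
rewrite [leRHS]mulrDl; apply: (le_trans (ler_normB _ _)); apply: lerD.
  by apply: (le_trans hz); rewrite ler_wpM2l// ltW.
have P2 : `|P| <= 2^-1.
  by rewrite ler_norml /P; move: (Phi_ge0 z) (Phi_le1 z); clear; lra.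
rewrite normrM; apply: (le_trans (ler_pM _ _ P2 hA)) => //.
by have -> : 2^-1 * (2 * K5 * e) = K5 * e by field.
Qed.

End binomial_gauss.

(** * Substituting a perturbed argument into the normal expansion *)
Section taylor.
Context (R : realType).

Lemma taylor3_01 (g g1 g2 g3 : R -> R) (B : R) :
  (forall t : R, is_derive t 1 g (g1 t)) -> (forall t : R, is_derive t 1 g1 (g2 t)) ->
  (forall t : R, is_derive t 1 g2 (g3 t)) ->
  (forall t, 0 <= t <= 1 -> `|g3 t| <= B) ->
  `|g 1 - g 0 - g1 0 - g2 0 / 2| <= B.
Proof.
move=> d0 d1 d2 hB.
have B0 : 0 <= B by apply: le_trans (hB 0 _); rewrite ?normr_ge0// lexx ler01.
have b2 t : 0 <= t <= 1 -> `|g2 t - g2 0| <= B * t.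
  move=> /andP[t0 t1].
  have := @drv_bound R g2 (fun t => B * t) g3 (fun t => B * 1) 0 t t0.
  rewrite mulr0 subr0; apply => // u /andP[u0 ut].
  by rewrite mulr1 hB// u0 (le_trans ut).
have b1 t : 0 <= t <= 1 -> `|g1 t - (g1 0 + g2 0 * t)| <= B * t ^+ 2.
  move=> /andP[t0 t1].
  have := @drv_bound R (fun t => g1 t - (g1 0 + g2 0 * t)) (fun t => B * t ^+ 2)
    (fun t => g2 t - g2 0) (fun t => B * (2 * t)) 0 t t0.
  rewrite !mulr0 addr0 subrr subr0 expr0n mulr0 subr0; apply => // u /andP[u0 ut].
  - apply: (is_derive_eq (drvB (d1 u) (drvD (drv_cst _ _) (drvZ (g2 0) (drv_id u))))).
    by rewrite add0r mulr1.
  - apply: (is_derive_eq (drvZ B (drvX 2 (drv_id u)))).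
    by rewrite /= expr1 mulr1.
  - apply: (le_trans (b2 u _)); first by rewrite u0 (le_trans ut).
    by rewrite ler_wpM2l//; lra.
have := @drv_bound R (fun t => g t - (g 0 + g1 0 * t + g2 0 / 2 * t ^+ 2))
   (fun t => B * t ^+ 3) (fun t => g1 t - (g1 0 + g2 0 * t)) (fun t => B * (3 * t ^+ 2)) 0 1 ler01.
rewrite !mulr0 !expr0n !mulr0 !addr0 subrr subr0 !expr1n !mulr1 subr0.
rewrite (_ : g 1 - g 0 - g1 0 - g2 0 / 2 = g 1 - (g 0 + g1 0 + g2 0 / 2)); last by ring.
apply => t /andP[t0 t1].
- apply: (is_derive_eq (drvB (d0 t) (drvD (drvD (drv_cst _ _) (drvZ (g1 0) (drv_id t)))
    (drvZ (g2 0 / 2) (drvX 2 (drv_id t)))))).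
  by rewrite /=; field.
- apply: (is_derive_eq (drvZ B (drvX 3 (drv_id t)))).
  by rewrite /= mulr1.
- apply: (le_trans (b1 t _)); first by rewrite t0 t1.
  rewrite ler_wpM2l//; have := sqr_ge0 t; lra.
Qed.

End taylor.

Section near_far.
Context (R : realType).
Notation phi := (@std_normal_pdf R).
Notation Phi := (@std_normal_cdf R).
Implicit Types (x z a b m i : R).

Definition quartic_correction z : R := (3 * z + z ^+ 3) * phi z.

Lemma quartic_correction_drv z : is_derive z 1 quartic_correction ((3 - z ^+ 4) * phi z).
Proof.
apply: (is_derive_eq (drvM (drvD (drvZ 3 (drv_id z)) (drvX 3 (drv_id z))) (phi_drv z))).
by rewrite /=; ring.
Qed.

Lemma line_drv x d (t : R) : is_derive t 1 (fun t => x + t * d) d.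
Proof.
apply: (is_derive_eq (drvD (drv_cst x t) (drvM (drv_id t) (drv_cst d t)))).
by rewrite mulr0 addr0 add0r mul1r.
Qed.

(** On the segment from x to x + d, which stays above x/2, the third derivative
    (u^2 - 1) phi u is at most a constant over x^6. *)
Lemma Phi_taylor : exists2 C, 0 < C & forall x d, 0 < x -> `|d| <= x / 2 ->
  `|Phi (x + d) - Phi x - d * phi x + d ^+ 2 * x * phi x / 2| <= C * `|d| ^+ 3 / x ^+ 6.
Proof.
have [c6 c60 h6] := @phi_pow_bounded R 6.
have [c8 c80 h8] := @phi_pow_bounded R 8.
exists (64 * (c6 + c8)); first by rewrite mulr_gt0// addr_gt0.
move=> x d x0; rewrite ler_norml => /andP[d1 d2].
have := @taylor3_01 R (fun t => Phi (x + t * d)) (fun t => d * phi (x + t * d))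
  (fun t => d ^+ 2 * (- (x + t * d) * phi (x + t * d)))
  (fun t => d ^+ 3 * (((x + t * d) ^+ 2 - 1) * phi (x + t * d)))
  (64 * (c6 + c8) * `|d| ^+ 3 / x ^+ 6).
rewrite mul0r mul1r addr0.
have -> : Phi (x + d) - Phi x - d * phi x + d ^+ 2 * x * phi x / 2 =
  Phi (x + d) - Phi x - d * phi x - d ^+ 2 * (- x * phi x) / 2 by ring.
apply.
- move=> t; apply: (is_derive_eq (drv_comp (line_drv x d t) (Phi_drv _))).
  by rewrite mulrC.
- move=> t; apply: (is_derive_eq (drvZ d (drv_comp (line_drv x d t) (phi_drv _)))).
  by ring.
- move=> t.
  apply: (is_derive_eq (drvZ (d ^+ 2) (drvM (drvN (line_drv x d t))
    (drv_comp (line_drv x d t) (phi_drv _))))).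
  by ring.
- move=> t /andP[t0 t1]; set u := x + t * d.
  have ux : x / 2 <= u by rewrite /u; nra.
  have u0 : 0 <= u by apply: le_trans ux; rewrite divr_ge0// ltW.
  rewrite normrM normrX [leRHS]mulrAC mulrC ler_wpM2r ?exprn_ge0//.
  rewrite ler_pdivlMr ?exprn_gt0//.
  have x6 : x ^+ 6 <= 64 * u ^+ 6.
    have -> : 64 * u ^+ 6 = (2 * u) ^+ 6 by ring.
    by rewrite lerXn2r ?nnegrE ?mulr_ge0// ?(ltW x0)//; lra.
  apply: (@le_trans _ _ ((u ^+ 2 + 1) * phi u * (64 * u ^+ 6))).
    rewrite normrM (ger0_norm (phi_ge0 u)) ler_pM ?mulr_ge0 ?phi_ge0 ?exprn_ge0 ?(ltW x0)//.
    rewrite ler_wpM2r ?phi_ge0// ler_norml; have := sqr_ge0 u; lra.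
  have -> : (u ^+ 2 + 1) * phi u * (64 * u ^+ 6) =
     64 * (u ^+ 6 * phi u + u ^+ 8 * phi u) by ring.
  by rewrite ler_wpM2l// lerD ?h6 ?h8.
Qed.

Lemma quartic_correction_lip : exists2 C, 0 < C & forall x d, 0 < x -> `|d| <= x / 2 ->
  `|quartic_correction (x + d) - quartic_correction x| <= C * `|d| / x ^+ 2.
Proof.
have [c2 c20 h2] := @phi_pow_bounded R 2.
have [c6 c60 h6] := @phi_pow_bounded R 6.
exists (4 * (3 * c2 + c6)); first by rewrite mulr_gt0// addr_gt0// mulr_gt0.
move=> x d x0; rewrite ler_norml => /andP[d1 d2].
set B := _ / _.
have := @drv_bound R (fun t => quartic_correction (x + t * d)) (fun t => B * t)
  (fun t => d * ((3 - (x + t * d) ^+ 4) * phi (x + t * d))) (fun t => B * 1) 0 1 ler01.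
rewrite mul0r mul1r addr0 mulr0 subr0 mulr1; apply.
- move=> t _; apply: (is_derive_eq (drv_comp (line_drv x d t) (quartic_correction_drv _))).
  by rewrite mulrC.
- by move=> t _; apply: (is_derive_eq (drvZ B (drv_id t))); rewrite ?mulr1.
- move=> t /andP[t0 t1]; set u := x + t * d.
  have ux : x / 2 <= u by rewrite /u; nra.
  have u0 : 0 <= u by apply: le_trans ux; rewrite divr_ge0// ltW.
  rewrite /B normrM mulrAC mulrC ler_wpM2r//.
  rewrite ler_pdivlMr ?exprn_gt0//.
  have x2 : x ^+ 2 <= 4 * u ^+ 2.
    have -> : 4 * u ^+ 2 = (2 * u) ^+ 2 by ring.
    by rewrite lerXn2r ?nnegrE ?mulr_ge0// ?(ltW x0)//; lra.
  apply: (@le_trans _ _ ((u ^+ 4 + 3) * phi u * (4 * u ^+ 2))).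
    rewrite normrM (ger0_norm (phi_ge0 u)) ler_pM ?mulr_ge0 ?phi_ge0 ?exprn_ge0 ?(ltW x0)//.
    rewrite ler_wpM2r ?phi_ge0// ler_norml; have : 0 <= u ^+ 4 by rewrite exprn_ge0.
    lra.
  have -> : (u ^+ 4 + 3) * phi u * (4 * u ^+ 2) =
     4 * (3 * (u ^+ 2 * phi u) + u ^+ 6 * phi u) by ring.
  by rewrite ler_wpM2l// lerD ?h6// ler_wpM2l ?h2.
Qed.

(** Here i stands for 1/s, the point z for the image of x under the change of
    scale, and a, b for the coefficients in z = x + a x^2 i + b x^3 i^2 + O(x^4 i^3).
    The coefficient of i^2 collects the quartic correction, the cubic term of z, and
    the second-order term - x phi x (a x^2)^2 / 2 of Phi. *)
Definition substitution_error a b i x z : R :=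
  Phi z + quartic_correction z / 4 * i ^+ 2 - Phi x - a * x ^+ 2 * phi x * i
  - ((3 * x + x ^+ 3) / 4 + b * x ^+ 3 - a ^+ 2 * x ^+ 5 / 2) * phi x * i ^+ 2.

(** As x i stays small, |z - x| is at most A x^2 i and at most x/2; the Gaussian
    factors then absorb all powers of x. *)
Lemma substitution_near a b m : 0 <= m -> exists e K : R, [/\ 0 < e, 0 < K &
  forall i x z, 0 < i -> i <= 1 -> 0 <= x -> x * i <= e ->
  `|z - (x + a * x ^+ 2 * i + b * x ^+ 3 * i ^+ 2)| <= m * x ^+ 4 * i ^+ 3 ->
  x / 2 <= z /\ `|substitution_error a b i x z| <= K * i ^+ 3].
Proof.
move=> m0.
have [c4 c40 h4] := @phi_pow_bounded R 4.
have [c6 c60 h6] := @phi_pow_bounded R 6.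
have [C C0 hC] := Phi_taylor.
have [D D0 hD] := quartic_correction_lip.
have na := normr_ge0 a; have nb := normr_ge0 b.
pose A : R := `|a| + `|b| + m.
have A0 : 0 <= A by rewrite !addr_ge0.
pose K := C * A ^+ 3 + m * c4 + (`|b| + m) * (A + `|a|) * c6 + D * A + 1.
exists ((2 * (A + 1))^-1), K; split.
- by rewrite invr_gt0 mulr_gt0// ltr_wpDl.
- by rewrite ltr_wpDl// !addr_ge0 ?mulr_ge0 ?addr_ge0 ?exprn_ge0// ltW.
move=> i x z i0 i1 x0 xi hz.
have xi1 : x * i <= 1.
  by apply: (le_trans xi); rewrite invf_le1 ?mulr_gt0//; lra.
have xi0 : 0 <= x * i by rewrite mulr_ge0// ltW.
pose d := z - x.
have zE : z = x + d by rewrite /d addrC subrK.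
have x3i : x ^+ 3 * i ^+ 2 <= x ^+ 2 * i.
  have -> : x ^+ 3 * i ^+ 2 = x ^+ 2 * i * (x * i) by ring.
  by rewrite ler_piMr// mulr_ge0 ?exprn_ge0// ltW.
have x4i : x ^+ 4 * i ^+ 3 <= x ^+ 3 * i ^+ 2.
  have -> : x ^+ 4 * i ^+ 3 = x ^+ 3 * i ^+ 2 * (x * i) by ring.
  by rewrite ler_piMr// mulr_ge0 ?exprn_ge0// ltW.
have x3i0 : 0 <= x ^+ 3 * i ^+ 2 by rewrite mulr_ge0 ?exprn_ge0// ltW.
have x2i0 : 0 <= x ^+ 2 * i by rewrite mulr_ge0 ?exprn_ge0// ltW.
have dm : `|d - a * (x ^+ 2 * i) - b * (x ^+ 3 * i ^+ 2)| <= m * (x ^+ 4 * i ^+ 3).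
  by move: hz; rewrite zE; congr (`| _ | <= _); ring.
have db : `|d - a * (x ^+ 2 * i)| <= (`|b| + m) * (x ^+ 3 * i ^+ 2).
  rewrite -[X in `|X|](subrK (b * (x ^+ 3 * i ^+ 2))).
  apply: (le_trans (ler_normD _ _)); rewrite addrC mulrDl lerD//.
    by rewrite normrM (ger0_norm x3i0).
  by apply: (le_trans dm); rewrite ler_wpM2l.
have d_none_above : `|d| <= A * (x ^+ 2 * i).
  rewrite -[X in `|X|](subrK (a * (x ^+ 2 * i))).
  apply: (le_trans (ler_normD _ _)); rewrite addrC /A -(addrA `|a|) mulrDl lerD//.
    by rewrite normrM (ger0_norm x2i0).
  by apply: (le_trans db); rewrite ler_wpM2l// addr_ge0.
have dx : `|d| <= x / 2.
  apply: (le_trans d_none_above); have -> : A * (x ^+ 2 * i) = x * (A * (x * i)) by ring.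
  rewrite ler_wpM2l//; apply: (@le_trans _ _ (A * (2 * (A + 1))^-1)).
    by rewrite ler_wpM2l.
  by rewrite ler_pdivrMr ?mulr_gt0//; clear -A0; lra.
split.
  by rewrite zE; move: dx; rewrite ler_norml => /andP[+ _]; clear; lra.
have i3 : 0 <= i ^+ 3 by rewrite exprn_ge0// ltW.
move: x0; rewrite le_eqVlt => /predU1P[x0|x0].
  have z0 : z = x.
    move: d_none_above; rewrite -x0 expr0n mul0r mulr0 normr_le0 => /eqP d0.
    by rewrite zE d0 addr0.
  rewrite /substitution_error z0 /quartic_correction -x0.
  rewrite !expr0n !(mulr0, mul0r, addr0, subr0) subrr normr0.
  by rewrite mulr_ge0// ltW// ltr_wpDl// !addr_ge0 ?mulr_ge0 ?addr_ge0 ?exprn_ge0// ltW.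
have phx := phi_ge0 x.
have T1 := hC x d x0 dx.
have T2 := hD x d x0 dx.
rewrite -zE in T1 T2.
have E1 : `|Phi z - Phi x - d * phi x + d ^+ 2 * x * phi x / 2| <= C * A ^+ 3 * i ^+ 3.
  apply: (le_trans T1); rewrite ler_pdivrMr ?exprn_gt0//.
  have -> : C * A ^+ 3 * i ^+ 3 * x ^+ 6 = C * (A * (x ^+ 2 * i)) ^+ 3 by ring.
  by rewrite ler_wpM2l ?(ltW C0)// lerXn2r ?nnegrE// mulr_ge0.
have E2 : `|(d - a * (x ^+ 2 * i) - b * (x ^+ 3 * i ^+ 2)) * phi x| <= m * c4 * i ^+ 3.
  rewrite normrM (ger0_norm phx).
  apply: (@le_trans _ _ (m * (x ^+ 4 * i ^+ 3) * phi x)); first by rewrite ler_wpM2r.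
  have -> : m * (x ^+ 4 * i ^+ 3) * phi x = m * (x ^+ 4 * phi x) * i ^+ 3 by ring.
  by rewrite ler_wpM2r// ler_wpM2l// h4// ltW.
have E3 : `|(d - a * (x ^+ 2 * i)) * (d + a * (x ^+ 2 * i)) * (x * phi x)|
    <= (`|b| + m) * (A + `|a|) * c6 * i ^+ 3.
  rewrite !normrM (ger0_norm phx) (gtr0_norm x0).
  apply: (@le_trans _ _ ((`|b| + m) * (x ^+ 3 * i ^+ 2) *
    ((A + `|a|) * (x ^+ 2 * i)) * (x * phi x))).
    rewrite ler_wpM2r ?mulr_ge0 ?(ltW x0)// ler_pM//.
    apply: (le_trans (ler_normD _ _)); rewrite mulrDl lerD//.
    by rewrite normrM (ger0_norm x2i0).
  rewrite [leLHS](_ : _ = (`|b| + m) * (A + `|a|) * (x ^+ 6 * phi x) * i ^+ 3); last by ring.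
  by rewrite ler_wpM2r// ler_wpM2l ?mulr_ge0 ?addr_ge0// h6// ltW.
have E4 : `|(quartic_correction z - quartic_correction x) * i ^+ 2| <= D * A * i ^+ 3.
  rewrite normrM [X in _ * X]ger0_norm ?exprn_ge0 ?(ltW i0)//.
  rewrite (_ : D * A * i ^+ 3 = D * A * i * i ^+ 2); last by ring.
  rewrite ler_wpM2r ?exprn_ge0 ?(ltW i0)//; apply: (le_trans T2).
  rewrite ler_pdivrMr ?exprn_gt0//.
  have -> : D * A * i * x ^+ 2 = D * (A * (x ^+ 2 * i)) by ring.
  by rewrite ler_wpM2l// ltW.
have -> : substitution_error a b i x z =
  (Phi z - Phi x - d * phi x + d ^+ 2 * x * phi x / 2)
  + (d - a * (x ^+ 2 * i) - b * (x ^+ 3 * i ^+ 2)) * phi x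
  - 2^-1 * ((d - a * (x ^+ 2 * i)) * (d + a * (x ^+ 2 * i)) * (x * phi x))
  + 4^-1 * ((quartic_correction z - quartic_correction x) * i ^+ 2).
  by rewrite /substitution_error /quartic_correction; field.
set w1 := Phi z - _ - _ + _ in E1 *; set w2 := _ * phi x in E2 *.
set w3 := _ * (x * phi x) in E3 *; set w4 := (_ - quartic_correction x) * _ in E4 *.
have tri : `|w1 + w2 - 2^-1 * w3 + 4^-1 * w4| <= `|w1| + `|w2| + `|w3| + `|w4|.
  apply: (le_trans (ler_normD _ _)); apply: lerD; last first.
    by rewrite normrM ger0_norm// ler_piMl//; clear; lra.
  apply: (le_trans (ler_normB _ _)); apply: lerD; first exact: ler_normD.
  by rewrite normrM ger0_norm// ler_piMl//; clear; lra.
apply: (le_trans tri); apply: (le_trans (lerD (lerD (lerD E1 E2) E3) E4)).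
by rewrite -!mulrDl ler_wpM2r// /K lerDl.
Qed.

(** Now 1/x and 1/z are O(i), so each term taken separately is O(i^3). *)
Lemma substitution_far a b e : 0 < e -> exists2 K, 0 < K &
  forall i x z, 0 < i -> i <= 1 -> e <= x * i -> e / 2 <= z * i ->
  `|substitution_error a b i x z| <= K * i ^+ 3.
Proof.
move=> e0.
have [c2 c20 h2] := @phi_pow_bounded R 2.
have [c4 c40 h4] := @phi_pow_bounded R 4.
have [c6 c60 h6] := @phi_pow_bounded R 6.
have [T T0 hT] := @Phi_tail R.
have na := normr_ge0 a; have nb := normr_ge0 b; have a2 := sqr_ge0 a.
pose r := 2 / e.
have r0 : 0 < r by rewrite divr_gt0.
pose K := 2 * T * r ^+ 3 + (3 * c2 + c4) * r + `|a| * c4 * r ^+ 2 +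
  (c2 + c4 + `|b| * c4 + a ^+ 2 * c6) * r + 1.
exists K.
  by rewrite ltr_wpDl// !(sqr_ge0, addr_ge0, mulr_ge0, exprn_ge0)// ?invr_ge0 ltW.
move=> i x z i0 i1 xi zi.
have inv u : e / 2 <= u * i -> 0 < u /\ u^-1 <= r * i.
  move=> h; have u0 : 0 < u.
    by rewrite -(pmulr_lgt0 _ i0); apply: lt_le_trans h; rewrite divr_gt0.
  split=> //; rewrite -[leLHS]mul1r ler_pdivrMr// /r.
  have -> : 2 / e * i * u = (u * i) / (e / 2) by field; rewrite gt_eqF.
  by rewrite ler_pdivlMr ?divr_gt0// mul1r.
have [z0 zr] := inv z zi.
have [x0 xr] : 0 < x /\ x^-1 <= r * i by apply: inv; lra.
have ri0 : 0 <= r * i by rewrite mulr_ge0// ltW.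
have tail u : 0 < u -> u^-1 <= r * i -> `|1 - Phi u| <= T * r ^+ 3 * i ^+ 3.
  move=> u0 ur; rewrite ger0_norm ?subr_ge0 ?Phi_le1//.
  apply: (le_trans (hT u u0)); rewrite -exprVn -mulrA -exprMn ler_wpM2l ?(ltW T0)//.
  by rewrite lerXn2r ?nnegrE ?invr_ge0// ltW.
have E1 := tail z z0 zr; have E2 := tail x x0 xr.
have phz := phi_ge0 z; have phx := phi_ge0 x.
have i20 : 0 <= i ^+ 2 by rewrite exprn_ge0// ltW.
have E3 : `|quartic_correction z / 4 * i ^+ 2| <= (3 * c2 + c4) * r * i ^+ 3.
  have -> : quartic_correction z / 4 = (3 * (z ^+ 2 * phi z) + z ^+ 4 * phi z) / 4 * z^-1.
    by rewrite /quartic_correction; field; rewrite gt_eqF.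
  rewrite (_ : _ * r * i ^+ 3 = (3 * c2 + c4) * (r * i) * i ^+ 2); last by ring.
  have ge : 0 <= (3 * (z ^+ 2 * phi z) + z ^+ 4 * phi z) / 4.
    by rewrite divr_ge0// addr_ge0 ?mulr_ge0 ?exprn_ge0 ?(ltW z0).
  rewrite ger0_norm; last by rewrite mulr_ge0// (mulr_ge0 ge)// invr_ge0 ltW.
  rewrite ler_wpM2r// ler_pM// ?invr_ge0 ?(ltW z0)//.
  move: (h2 _ (ltW z0)) (h4 _ (ltW z0)) ge c20 c40; clear; lra.
have E4 : `|a * x ^+ 2 * phi x * i| <= `|a| * c4 * r ^+ 2 * i ^+ 3.
  have x4 : 0 <= x ^+ 4 * phi x by rewrite mulr_ge0 ?exprn_ge0 ?(ltW x0).
  have -> : a * x ^+ 2 * phi x * i = a * (x ^+ 4 * phi x) * x^-1 ^+ 2 * i.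
    by field; rewrite gt_eqF.
  rewrite normrM (ger0_norm (ltW i0)) normrM normrM (ger0_norm x4).
  rewrite [X in _ * X * _]ger0_norm ?sqr_ge0//.
  rewrite (_ : _ * r ^+ 2 * i ^+ 3 = `|a| * c4 * (r * i) ^+ 2 * i); last by ring.
  rewrite ler_wpM2r ?(ltW i0)//; apply: ler_pM; [exact: mulr_ge0 na x4|exact: sqr_ge0| |].
    by rewrite ler_wpM2l// h4// ltW.
  by rewrite lerXn2r ?nnegrE ?invr_ge0// ltW.
have E5 : `|((3 * x + x ^+ 3) / 4 + b * x ^+ 3 - a ^+ 2 * x ^+ 5 / 2) * phi x * i ^+ 2|
   <= (c2 + c4 + `|b| * c4 + a ^+ 2 * c6) * r * i ^+ 3.
  rewrite (_ : _ * r * i ^+ 3 = (c2 + c4 + `|b| * c4 + a ^+ 2 * c6) * (r * i) * i ^+ 2); last by ring.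
  rewrite normrM [X in _ * X]ger0_norm// ler_wpM2r//.
  have -> : ((3 * x + x ^+ 3) / 4 + b * x ^+ 3 - a ^+ 2 * x ^+ 5 / 2) * phi x =
     (3 / 4 * (x ^+ 2 * phi x) + 4^-1 * (x ^+ 4 * phi x) + b * (x ^+ 4 * phi x)
       - a ^+ 2 / 2 * (x ^+ 6 * phi x)) * x^-1.
    by field; rewrite gt_eqF.
  rewrite normrM [X in _ * X]ger0_norm ?invr_ge0 ?(ltW x0)//.
  rewrite ler_pM ?invr_ge0 ?(ltW x0)//.
  have g2 : 0 <= x ^+ 2 * phi x by rewrite mulr_ge0 ?exprn_ge0// ltW.
  have g4 : 0 <= x ^+ 4 * phi x by rewrite mulr_ge0 ?exprn_ge0// ltW.
  have g6 : 0 <= x ^+ 6 * phi x by rewrite mulr_ge0 ?exprn_ge0// ltW.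
  have k2 := h2 _ (ltW x0); have k4 := h4 _ (ltW x0); have k6 := h6 _ (ltW x0).
  apply: (le_trans (ler_normB _ _)); apply: lerD; last first.
    rewrite ger0_norm; last by rewrite mulr_ge0// divr_ge0.
    by rewrite ler_pM ?divr_ge0//; lra.
  apply: (le_trans (ler_normD _ _)); apply: lerD; last first.
    by rewrite normrM (ger0_norm g4) ler_wpM2l.
  rewrite ger0_norm; last by move: g2 g4; clear; lra.
  by move: k2 k4 g2 g4; clear; lra.
have -> : substitution_error a b i x z = (1 - Phi x) - (1 - Phi z) + quartic_correction z / 4 * i ^+ 2
   - a * x ^+ 2 * phi x * i -
   ((3 * x + x ^+ 3) / 4 + b * x ^+ 3 - a ^+ 2 * x ^+ 5 / 2) * phi x * i ^+ 2.
  by rewrite /substitution_error; ring.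
set w5 := _ * phi x * i ^+ 2 in E5 *.
apply: (@le_trans _ _ (`|1 - Phi x| + `|1 - Phi z| + `|quartic_correction z / 4 * i ^+ 2| +
   `|a * x ^+ 2 * phi x * i| + `|w5|)).
  apply: (le_trans (ler_normB _ _)); apply: lerD => //.
  apply: (le_trans (ler_normB _ _)); apply: lerD => //.
  apply: (le_trans (ler_normD _ _)); apply: lerD => //.
  exact: ler_normB.
apply: (le_trans (lerD (lerD (lerD (lerD E2 E1) E3) E4) E5)).
rewrite -!mulrDl ler_wpM2r ?exprn_ge0 ?(ltW i0)// /K.
have -> : 2 * T * r ^+ 3 = (T + T) * r ^+ 3 by clear; ring.
by rewrite lerDl.
Qed.

End near_far.

(** * The density near its centre *)
Section at_zero.
Context (R : realType).
Implicit Types (f h : R -> R) (x : R).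

Lemma lipschitz_continuous_at f x (L d : R) : 0 < d ->
  (forall y, `|y - x| < d -> `|f y - f x| <= L * `|y - x|) ->
  {for x, continuous f}.
Proof.
move=> d0 hf; apply/cvgrPdist_lt => e e0.
have L1 : 0 < `|L| + 1 by rewrite ltr_wpDl.
near=> y.
have yd : `|y - x| < d.
  near: y; apply/nbhs_ballP; exists d => //= y; rewrite /ball/= distrC; exact.
have ye : `|y - x| < e / (`|L| + 1).
  near: y; apply/nbhs_ballP; exists (e / (`|L| + 1)); first exact: divr_gt0.
  by move=> y; rewrite /ball/= distrC.
rewrite distrC; apply: (le_lt_trans (hf _ yd)).
apply: (@le_lt_trans _ _ ((`|L| + 1) * `|y - x|)).
  by rewrite ler_wpM2r// (le_trans (ler_norm L))// lerDl.
by rewrite mulrC -ltr_pdivlMr.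
Unshelve. all: by end_near. Qed.

Lemma near_at_right0 (P : R -> Prop) (d : R) : 0 < d -> (forall x, 0 < x < d -> P x) ->
  \forall x \near 0^'+, P x.
Proof.
move=> d0 h; near=> x; apply: h; apply/andP; split; near: x.
  exact: nbhs_right_gt.
exact: nbhs_right_lt.
Unshelve. all: by end_near. Qed.

(** If |h'| <= M then h + M x is nondecreasing and bounded below near 0, hence
    has a right limit. *)
Lemma bounded_derivative_cvg h (h' : R -> R) (x0 M : R) : 0 < x0 ->
  (forall x, 0 < x < x0 -> is_derive x 1 h (h' x)) ->
  (forall x, 0 < x < x0 -> `|h' x| <= M) ->
  h x @[x --> 0^'+] --> lim (h x @[x --> 0^'+]).
Proof.
move=> x00 dh hM.
have lip a b : 0 < a -> a <= b -> b < x0 -> `|h b - h a| <= M * b - M * a.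
  move=> a0 ab b0.
  apply: (@drv_bound R h (fun t => M * t) h' (fun _ => M * 1) a b ab) => t /andP[at' tb].
  - by apply: dh; rewrite (lt_le_trans a0 at') (le_lt_trans tb b0).
  - by rewrite mulr1; apply: hM; rewrite (lt_le_trans a0 at') (le_lt_trans tb b0).
have M0 : 0 <= M.
  by apply: le_trans (hM (x0 / 2) _); rewrite ?divr_gt0//= ?normr_ge0//; lra.
have : cvg (h x + M * x @[x --> 0^'+]).
  apply: nondecreasing_at_right_is_cvgr.
  - apply: (@near_at_right0 _ x0) => // x /andP[xpos xx0] a b.
    rewrite !in_itv/= => /andP[a0 ax] /andP[b0 bx] ab.
    have := lip a b a0 ab (lt_trans bx xx0).
    by rewrite ler_norml => /andP[+ _]; lra.
  - apply: (@near_at_right0 _ (x0 / 2)) => [|x /andP[xpos xx0]]; first by rewrite divr_gt0.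
    exists (h (x0 / 2) - M * x0) => y [a /=]; rewrite in_itv/= => /andP[a0 ax] <-.
    have := lip a (x0 / 2) a0.
    have ha : a <= x0 / 2 by lra.
    have hx : x0 / 2 < x0 by lra.
    move=> /(_ ha hx); rewrite ler_norml => /andP[_ +].
    have : 0 <= M * a by rewrite mulr_ge0// ltW.
    have : 0 <= M * x0 by rewrite mulr_ge0// ltW.
    by lra.
move=> c.
have -> : h = (fun x => (h x + M * x) - M * x) by apply/funext => x; rewrite addrK.
apply: is_cvgB; first exact: c.
apply: is_cvgMr.
apply/cvg_ex; exists 0; apply: cvg_at_right_filter; exact: cvg_id.
Qed.

(** Applied repeatedly, from the highest derivative down to the distribution
    function, this yields Taylor's formula at 0+ without derivatives at 0 itself. *)
Lemma integrate_bound_at_right0 h (h' : R -> R) (x0 C : R) k : 0 < x0 ->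
  (forall x, 0 < x < x0 -> is_derive x 1 h (h' x)) ->
  (forall x, 0 < x < x0 -> `|h' x| <= C * x ^+ k) ->
  h x @[x --> 0^'+] --> 0 ->
  forall x, 0 < x < x0 -> `|h x| <= C * x ^+ k.+1.
Proof.
move=> x00 dh hM h0 x /andP[xpos xx0].
have C0 : 0 <= C.
  have := le_trans (normr_ge0 _) (hM x _); rewrite xpos xx0 => /(_ isT).
  by rewrite pmulr_lge0// exprn_gt0.
have : `|h x - h y| @[y --> 0^'+] --> `|h x - 0|.
  by apply: cvg_norm; apply: cvgB h0; exact: cvg_cst.
rewrite subr0 => /cvgr_to_le; apply.
apply: (@near_at_right0 _ x) => // y /andP[y0 yx].
have := @drv_bound R h (fun t => C / k.+1%:R * t ^+ k.+1) h' (fun t => C * t ^+ k) y x (ltW yx).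
move=> /(_ _ _ _)/le_trans; apply.
- move=> t /andP[yt tx]; apply: dh.
  by rewrite (lt_le_trans y0 yt) (le_lt_trans tx xx0).
- move=> t _; apply: (is_derive_eq (drvZ _ (drvX k.+1 (drv_id t)))).
  by rewrite /=; field; rewrite nat1r pnatr_eq0.
- move=> t /andP[yt tx]; apply: hM.
  by rewrite (lt_le_trans y0 yt) (le_lt_trans tx xx0).
- have e0 : 0 <= C / k.+1%:R * y ^+ k.+1.
    by rewrite mulr_ge0 ?exprn_ge0 ?divr_ge0// ltW.
  apply: (@le_trans _ _ (C / k.+1%:R * x ^+ k.+1)); first by rewrite /= lerBlDr lerDl.
  rewrite ler_wpM2r ?exprn_ge0 ?(ltW xpos)// ler_pdivrMr ?ltr0n// ler_peMr//.
  by rewrite ler1n.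
Qed.

End at_zero.

Section local_law.
Context (R : realType) (p : R -> R).
Hypothesis hp : assumptionA p.
Notation F := (density_cdf p).
Notation p0 := (p 0).
Notation p1 := (right_deriv0 p 1).
Notation p2 := (right_deriv0 p 2).

Lemma assumptionA_density : is_density p. Proof. by case: hp. Qed.
Lemma assumptionA_sym x : p (- x) = p x. Proof. by case: hp. Qed.
Lemma p0_gt0 : 0 < p0. Proof. by case: hp. Qed.

Lemma p_abs x : p `|x| = p x.
Proof. by case: (ger0P x) => // _; exact: assumptionA_sym. Qed.

(** The Lipschitz bound crosses 0 because p is even: p a - p b only depends on |a|
    and |b|, and right-continuity at 0 covers the case of the centre. *)
Lemma local_density : exists x1 M : R, [/\ 0 < x1, 0 < M,
  forall x, 0 < x < x1 -> `|p x - p0| <= M * x,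
  forall a b, `|a| < x1 -> `|b| < x1 -> `|p a - p b| <= M * `|a - b| &
  forall x, 0 < x < x1 ->
   `|p x - (p0 + p1 * x + p2 / 2 * x ^+ 2)| <= M * x ^+ 3].
Proof.
have [_ _ _ cp [x0 x00 [dp bp]]] := hp.
have d k x : (k < 3)%N -> 0 < x < x0 ->
    is_derive x 1 (derive1n k p) (derive1n k.+1 p x).
  move=> k3 hx; have := dp k x k3 hx => h.
  by rewrite derive1nS derive1E; apply: DeriveDef.
have [_ [M1 hM1]] := bp 1%N isT.
have [_ [M2 hM2]] := bp 2%N isT.
have [_ [M3 hM3]] := bp 3%N isT.
have c1 : derive1n 1 p x @[x --> 0^'+] --> p1.
  exact: (bounded_derivative_cvg x00 (d 1%N ^~ isT) hM2).
have c2 : derive1n 2 p x @[x --> 0^'+] --> p2.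
  exact: (bounded_derivative_cvg x00 (d 2%N ^~ isT) hM3).
have {d dp bp}[d0 d1 d2] : [/\ forall x, 0 < x < x0 -> is_derive x 1 p (derive1n 1 p x),
    forall x, 0 < x < x0 -> is_derive x 1 (derive1n 1 p) (derive1n 2 p x) &
    forall x, 0 < x < x0 -> is_derive x 1 (derive1n 2 p) (derive1n 3 p x)].
  by split => x hx; [exact: (d 0%N)|exact: (d 1%N)|exact: (d 2%N)].
move: (derive1n 1 p) (derive1n 2 p) (derive1n 3 p) p1 p2 => g1 g2 g3 q1 q2
  in hM1 hM2 hM3 c1 c2 d0 d1 d2 *.
have cl (f : R -> R) l (q : R -> R) : f x @[x --> 0^'+] --> l -> q 0 = l -> {for 0, continuous q} ->
    f x - q x @[x --> 0^'+] --> 0.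
  move=> hf ql hq; have : f x - q x @[x --> 0^'+] --> l - q 0.
    by apply: cvgB; [exact: hf|exact: cvg_at_right_filter].
  by rewrite ql subrr.
have dq (x : R) : is_derive x 1 (fun x => q1 + q2 * x) q2.
  apply: (is_derive_eq (drvD (drv_cst _ _) (drvZ _ (drv_id _)))).
  by rewrite add0r mulr1.
have dq2 (x : R) : is_derive x 1 (fun x => p0 + q1 * x + q2 / 2 * x ^+ 2) (q1 + q2 * x).
  apply: (is_derive_eq (drvD (drvD (drv_cst _ _) (drvZ _ (drv_id _))) (drvZ _ (drvX 2 (drv_id x))))).
  by rewrite /=; field.
(* Integrate the bound on the third derivative three times. *)
have e2 x : 0 < x < x0 -> `|g2 x - q2| <= M3 * x ^+ 1.
  apply: (@integrate_bound_at_right0 R (fun x => g2 x - q2) (fun x => g3 x - 0)) => //.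
  - by move=> y hy; apply: drvB (drv_cst _ _); exact: d2.
  - by move=> y hy; rewrite subr0 expr0 mulr1 hM3.
  - by apply: (cl _ q2 (fun=> q2)) => //; exact: cvg_cst.
have e1 x : 0 < x < x0 -> `|g1 x - (q1 + q2 * x)| <= M3 * x ^+ 2.
  apply: (@integrate_bound_at_right0 R (fun x => g1 x - (q1 + q2 * x))
    (fun x => g2 x - q2)) => //.
  - by move=> y hy; apply: drvB => //; exact: d1.
  - apply: (cl _ q1) => //; first by rewrite mulr0 addr0.
    exact: drv_cont (dq 0).
have e0 x : 0 < x < x0 -> `|p x - (p0 + q1 * x + q2 / 2 * x ^+ 2)| <= M3 * x ^+ 3.
  apply: (@integrate_bound_at_right0 R (fun x => p x - (p0 + q1 * x + q2 / 2 * x ^+ 2))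
    (fun x => g1 x - (q1 + q2 * x))) => //.
  - by move=> y hy; apply: drvB => //; exact: d0.
  - apply: (cl _ p0) => //; first by rewrite expr0n !mulr0 !addr0.
    exact: drv_cont (dq2 0).
have e x : 0 < x < x0 -> `|p x - p0| <= M1 * x ^+ 1.
  apply: (@integrate_bound_at_right0 R (fun x => p x - p0) (fun x => g1 x - 0)) => //.
  - by move=> y hy; apply: drvB (drv_cst _ _); exact: d0.
  - by move=> y hy; rewrite subr0 expr0 mulr1 hM1.
  - by apply: (cl _ p0 (fun=> p0)) => //; exact: cvg_cst.
have hx2 : 0 < x0 / 2 < x0 by rewrite divr_gt0//=; lra.
have M10 := le_trans (normr_ge0 _) (hM1 _ hx2).
have M30 := le_trans (normr_ge0 _) (hM3 _ hx2).
pose M := M1 + M3 + 1.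
exists x0, M; split => //.
- by rewrite /M; lra.
- move=> x hx; apply: (le_trans (e x hx)); rewrite expr1 ler_wpM2r//.
    by case/andP: hx => /ltW.
  by rewrite /M; lra.
- have lip a b : 0 <= a -> a <= b -> b < x0 -> `|p b - p a| <= M1 * (b - a).
    move=> a0 ab b0; have [->|an] := eqVneq a 0.
      have [->|bn] := eqVneq b 0; first by rewrite !subrr normr0 mulr0.
      by rewrite subr0; apply: (e b); rewrite b0 lt0r bn (le_trans a0 ab).
    rewrite mulrBr.
    have apos : 0 < a by rewrite lt0r an.
    apply: (@drv_bound R p (fun t => M1 * t) (g1) (fun _ => M1 * 1) a b ab) => t /andP[at' tb].
    + by apply: d0 => //; rewrite (lt_le_trans apos at') (le_lt_trans tb b0).
    + by rewrite mulr1; apply: hM1; rewrite (lt_le_trans apos at') (le_lt_trans tb b0).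
  move=> a b ha hb; apply: (@le_trans _ _ (M1 * `|a - b|)); last first.
    by rewrite ler_wpM2r// /M; lra.
  rewrite -(p_abs a) -(p_abs b).
  apply: (@le_trans _ _ (M1 * Num.norm (`|a| - `|b|))); last first.
    by rewrite ler_wpM2l// ler_dist_dist.
  have [ab|/ltW ba] := leP `|a| `|b|.
    rewrite distrC [X in _ <= _ * X]distrC [X in _ <= _ * X]ger0_norm ?subr_ge0//.
    exact: lip.
  rewrite [X in _ <= _ * X]ger0_norm ?subr_ge0//; exact: lip.
- move=> x hx; apply: (le_trans (e0 x hx)); rewrite ler_wpM2r ?exprn_ge0//.
    by case/andP: hx => /ltW.
  by rewrite /M; lra.
Qed.

Lemma local_cdf : exists x1 M : R, [/\ 0 < x1 /\ 0 < M,
  forall x : R, `|x| < x1 -> is_derive x 1 F (p x),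
  forall x, `|x| < x1 -> p0 / 2 <= p x <= 2 * p0,
  forall a b, `|a| < x1 -> `|b| < x1 -> `|p a - p b| <= M * `|a - b| &
  forall x, 0 <= x < x1 ->
   `|F x - (2^-1 + p0 * x + p1 / 2 * x ^+ 2 + p2 / 6 * x ^+ 3)| <= M * x ^+ 4].
Proof.
have [x0 [M [x00 M0 hp0 lip hp3]]] := local_density.
have pp := p0_gt0.
move: p1 p2 => q1 q2 in hp3 *.
pose x1 := Num.min x0 (p0 / (2 * M)).
have x10 : 0 < x1 by rewrite lt_min x00 divr_gt0// mulr_gt0.
have x1x0 : x1 <= x0 by rewrite ge_min lexx.
have x1M : M * x1 <= p0 / 2.
  rewrite mulrC -ler_pdivlMr// ge_min; apply/orP; right.
  by rewrite le_eqVlt; apply/orP; left; apply/eqP; field; rewrite gt_eqF.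
have dF (x : R) : `|x| < x1 -> is_derive x 1 F (p x).
  move=> hx; have hx0 := lt_le_trans hx x1x0.
  apply: (density_cdf_is_derive assumptionA_density).
  apply: (@lipschitz_continuous_at _ _ _ M (x0 - `|x|)); first by rewrite subr_gt0.
  move=> y hy; apply: lip => //.
  have -> : y = x + (y - x) by rewrite addrC subrK.
  by apply: (le_lt_trans (ler_normD _ _)); rewrite -ltrBrDl.
have F0 : F 0 = 2^-1.
  by have := density_cdf_sym assumptionA_density 0 assumptionA_sym; rewrite oppr0; lra.
exists x1, M; split => //.
- move=> x hx.
  have := lip x 0 (lt_le_trans hx x1x0); rewrite normr0 subr0 => /(_ x00).
  rewrite ler_norml => /andP[]; have : M * `|x| <= M * x1 by rewrite ler_wpM2l// ltW.
  by move: x1M pp; clear; lra.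
- by move=> a b ha hb; apply: lip; exact: lt_le_trans x1x0.
- have dq (x : R) : is_derive x 1
     (fun x => 2^-1 + p0 * x + q1 / 2 * x ^+ 2 + q2 / 6 * x ^+ 3) (p0 + q1 * x + q2 / 2 * x ^+ 2).
    apply: (is_derive_eq (drvD (drvD (drvD (drv_cst _ _) (drvZ _ (drv_id _)))
      (drvZ _ (drvX 2 (drv_id x)))) (drvZ _ (drvX 3 (drv_id x))))).
    by rewrite /=; field.
  move=> x /andP[]; rewrite le_eqVlt => /predU1P[<- _|xpos xx1].
    by rewrite F0 !expr0n !mulr0 !addr0 subrr normr0.
  apply: (@integrate_bound_at_right0 R
    (fun x => F x - (2^-1 + p0 * x + q1 / 2 * x ^+ 2 + q2 / 6 * x ^+ 3))
    (fun x => p x - (p0 + q1 * x + q2 / 2 * x ^+ 2)) x1) => //.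
  - move=> y /andP[y0 yx]; apply: drvB (dq _).
    by apply: dF; rewrite gtr0_norm.
  - by move=> y /andP[y0 yx]; apply: hp3; rewrite y0 (lt_le_trans yx).
  - have : F x - (2^-1 + p0 * x + q1 / 2 * x ^+ 2 + q2 / 6 * x ^+ 3)
        @[x --> 0^'+] --> F 0 - (2^-1 + p0 * 0 + q1 / 2 * 0 ^+ 2 + q2 / 6 * 0 ^+ 3).
      apply: cvgB; apply: cvg_at_right_filter; last exact: drv_cont (dq 0).
      by apply: (drv_cont (dF 0 _)); rewrite normr0.
    by rewrite F0 !expr0n !mulr0 !addr0 subrr.
  - by rewrite xpos.
Qed.

End local_law.

(** * The expansion for odd sample sizes *)
Section expansion.
Context (R : realType) (p : R -> R).
Hypothesis hp : assumptionA p.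
Notation F := (density_cdf p).
Notation p0 := (p 0).
Notation phi := (@std_normal_pdf R).
Notation Phi := (@std_normal_cdf R).

Definition median_error (n : nat) (s x : R) : R :=
  odd_median_cdf n (2 * F (x / (2 * p0 * s)) - 1) - Phi x - f1 p x / s - f2 p x / s ^+ 2.

(** Every term is odd in x once Phi and the law of the median are centred at 1/2; this
    is where the factor |x| in f1 is needed. *)
Lemma median_errorN n s x : median_error n s (- x) = - median_error n s x.
Proof.
rewrite /median_error mulNr (density_cdf_sym (assumptionA_density hp) _ (assumptionA_sym hp)).
have -> : 2 * (1 - F (x / (2 * p0 * s))) - 1 = - (2 * F (x / (2 * p0 * s)) - 1) by ring.
rewrite odd_median_cdfN PhiN.
have -> : f1 p (- x) = - f1 p x.
  rewrite /f1 normrN phiN; move: (right_deriv0 p 1) (phi x) => q w; ring.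
have -> : f2 p (- x) = - f2 p x.
  rewrite /f2 phiN sqrrN (_ : (- x) ^+ 4 = x ^+ 4); last by ring.
  move: (right_deriv0 p 1) (right_deriv0 p 2) (phi x) => q1 q2 w; ring.
move: (f1 p x) (f2 p x) (odd_median_cdf _ _) (Phi x) => *; ring.
Qed.

Lemma density_cdf_half : F 0 = 2^-1.
Proof.
have := density_cdf_sym (assumptionA_density hp) 0 (assumptionA_sym hp).
by rewrite oppr0; lra.
Qed.

Lemma odd_median_expansion : exists2 K : R, 0 < K & forall (n : nat) (s x : R),
  (0 < n)%N -> 0 < s -> s ^+ 2 = n.*2%:R ->
  `|median_error n s x| <= K / s ^+ 3.
Proof.
have [x1 [M [[x10 M0] _ _ _ hF]]] := local_cdf hp.
have pp := p0_gt0 hp.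
have [p1 p1E] : exists q, q = right_deriv0 p 1 by eexists.
have [p2 p2E] : exists q, q = right_deriv0 p 2.
  exact: (ex_intro _ (right_deriv0 p 2) erefl).
rewrite -p1E -p2E in hF.
pose a := p1 / (4 * p0 ^+ 2); pose b := p2 / (24 * p0 ^+ 3).
pose m := M / (8 * p0 ^+ 4).
have m0 : 0 <= m by rewrite divr_ge0 ?mulr_ge0 ?exprn_ge0// ltW.
have [e0 [K1 [e00 K10 near]]] := substitution_near a b m0.
pose e := Num.min e0 (p0 * x1).
have ee0 : e <= e0 by rewrite ge_min lexx.
have ex1 : e <= p0 * x1 by rewrite ge_min lexx orbT.
have epos : 0 < e by rewrite lt_min e00 mulr_gt0.
have [K2 K20 far] := substitution_far a b epos.
have [K3 K30 bg] := @odd_median_cdf_gauss R.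
have pN0 : p0 != 0 by rewrite gt_eqF.
exists (K1 + K2 + K3); first by rewrite !addr_gt0.
move=> n s x n0 s0 sn.
(* All quantities are odd in x, and the Taylor data live at 0+. *)
wlog x0 : x / 0 <= x.
  move=> w; have [|/ltW xl] := leP 0 x; first exact: w.
  by rewrite -normrN -median_errorN; apply: w; rewrite oppr_ge0.
have sN0 : s != 0 by rewrite gt_eqF.
have s2 : 2 <= s ^+ 2 by rewrite sn (ler_nat _ 1.*2) leq_double.
have s1 : 1 <= s.
  by rewrite -(@ler_pXn2r _ 2) ?nnegrE ?(ltW s0)// expr1n; move: s2; clear; lra.
pose i := s^-1.
have i0 : 0 < i by rewrite invr_gt0.
have i1 : i <= 1 by rewrite invf_le1.
pose Z (t : R) := s * (2 * F (t / (2 * p0 * s)) - 1).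
have Znd t t' : t <= t' -> Z t <= Z t'.
  move=> tt'; rewrite /Z ler_wpM2l ?(ltW s0)// lerB// ler_wpM2l//.
  apply: (density_cdf_nd (assumptionA_density hp)).
  by rewrite ler_wpM2r// invr_ge0 !mulr_ge0// ltW.
have Z0 : Z 0 = 0 by rewrite /Z mul0r density_cdf_half divff// subrr mulr0.
have Zx0 : 0 <= Z x by rewrite -Z0; exact: Znd.
have Zxs : Z x <= s.
  rewrite /Z -[leRHS]mulr1 ler_wpM2l ?(ltW s0)//.
  by move: (density_cdf_le1 (assumptionA_density hp) (x / (2 * p0 * s))); clear; lra.
have Zs : 2 * F (x / (2 * p0 * s)) - 1 = Z x / s by rewrite /Z [s * _]mulrC mulfK.
have i3 : 0 <= i ^+ 3 by rewrite exprn_ge0// ltW.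
have E3 c : c / s ^+ 3 = c * i ^+ 3 by rewrite /i exprVn.
have main : `|substitution_error a b i x (Z x)| <= (K1 + K2) * i ^+ 3 ->
    `|median_error n s x| <= (K1 + K2 + K3) / s ^+ 3.
  move=> h; have hb := bg n s (Z x) n0 s0 sn Zx0 Zxs.
  have -> : median_error n s x = substitution_error a b i x (Z x) + (odd_median_cdf n (Z x / s) - corrected_normal_cdf s (Z x)).
    rewrite /median_error Zs /substitution_error /corrected_normal_cdf /quartic_correction /f1 /f2 (ger0_norm x0) -p1E -p2E.
    by rewrite /a /b /i; field; rewrite pN0 sN0.
  rewrite mulrDl; apply: (le_trans (ler_normD _ _)); apply: lerD => //.
  by rewrite E3.
apply: main.
have nearZ t : 0 <= t -> t * i <= e ->
    `|Z t - (t + a * t ^+ 2 * i + b * t ^+ 3 * i ^+ 2)| <= m * t ^+ 4 * i ^+ 3.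
  move=> t0 te; set y := t / (2 * p0 * s).
  have yE : y = t * i / (2 * p0) by rewrite /y /i; field; rewrite pN0 sN0.
  have y0 : 0 <= y by rewrite divr_ge0// !mulr_ge0// ltW.
  have yx1 : y < x1.
    rewrite yE ltr_pdivrMr ?mulr_gt0//; apply: (le_lt_trans te).
    apply: (le_lt_trans ex1); rewrite mulrC ltr_pM2l//.
    by rewrite ltr_pMl// ltr1n.
  have := hF y; rewrite y0 yx1 => /(_ isT) hy.
  have tE : t = 2 * p0 * s * y by rewrite /y; field; rewrite pN0 sN0.
  have -> : Z t - (t + a * t ^+ 2 * i + b * t ^+ 3 * i ^+ 2) =
    2 * s * (F y - (2^-1 + p0 * y + p1 / 2 * y ^+ 2 + p2 / 6 * y ^+ 3)).
    by rewrite /Z -/y tE /a /b /i; field; rewrite pN0 sN0.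
  have -> : m * t ^+ 4 * i ^+ 3 = 2 * s * (M * y ^+ 4).
    by rewrite tE /m /i; field; rewrite pN0 sN0.
  by rewrite normrM ger0_norm ?mulr_ge0 ?(ltW s0)// ler_wpM2l// mulr_ge0// ltW.
have [xi|xi] := leP (x * i) e.
  have [_ h] := near i x (Z x) i0 i1 x0 (le_trans xi ee0) (nearZ x x0 xi).
  by apply: (le_trans h); rewrite ler_wpM2r// lerDl ltW.
(* Far out, monotonicity compares x with the last point of the near zone. *)
pose t := e * s.
have ti : t * i = e by rewrite /t /i mulfK.
have t0 : 0 <= t by rewrite mulr_ge0// ltW.
have te : t * i <= e by rewrite ti.
have [ht _] := near i t (Z t) i0 i1 t0 (le_trans te ee0) (nearZ t t0 te).
have tx : t <= x by rewrite /t -ler_pdivlMr// ltW.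
have h : `|substitution_error a b i x (Z x)| <= K2 * i ^+ 3.
  apply: far => //; first exact: ltW.
  rewrite -ti mulrAC ler_wpM2r ?(ltW i0)//.
  by apply: (le_trans ht); exact: Znd.
by apply: (le_trans h); rewrite ler_wpM2r// lerDr ltW.
Qed.

End expansion.

(** * The race between the nearest observations above and below *)
Section race.
Context (R : realType).

(** A quadratic error does not affect the derivative.  This is how the race law,
    known only through bounds on its increments, is differentiated. *)
Lemma quad_is_derive (f g : R -> R) (x a K d : R) : 0 < d ->
  is_derive x 1 g a ->
  (forall y, `|y - x| < d -> `|f y - f x - (g y - g x)| <= K * (y - x) ^+ 2) ->
  is_derive x 1 f a.
Proof.
move=> d0 dg hK.
pose r y := f y - g y.
have dr : is_derive x 1 r 0.
  apply/is_derive1_caratheodory.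
  exists (fun z => (r z - r x) / (z - x)); split.
  - move=> z; have [->|zx] := eqVneq z x; first by rewrite !subrr mulr0.
    by rewrite divfK// subr_eq0.
  - apply: (@lipschitz_continuous_at _ _ _ K d d0) => y hy.
    rewrite subrr mul0r subr0; have [->|yx] := eqVneq y x.
      by rewrite !subrr mul0r normr0 mulr0.
    have yx0 : 0 < `|y - x| by rewrite normr_gt0 subr_eq0.
    rewrite normrM normfV ler_pdivrMr// -mulrA -expr2 real_normK ?num_real//.
    by have := hK y hy; congr (`|_| <= _); rewrite /r; ring.
  - by rewrite subrr mul0r.
have -> : f = (fun y => r y + g y) by apply/funext => y; rewrite /r subrK.
by apply: (is_derive_eq (drvD dr dg)); rewrite add0r.
Qed.

Lemma central_binom_le (j : nat) (s : R) : 0 < s -> s ^+ 2 = j.*2%:R -> central_binom R j <= s^-1.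
Proof.
move=> s0 sj; have := central_binom_sqr R j => h.
rewrite -[leRHS]mul1r ler_pdivlMr//.
have c0 := ltW (central_binom_gt0 R j).
rewrite -(@ler_pXn2r _ 2) ?nnegrE ?mulr_ge0 ?(ltW s0)// expr1n exprMn sj.
by apply: le_trans h; rewrite ler_wpM2l ?sqr_ge0// ler_nat.
Qed.

Variables (F p : R -> R) (p0 x1 L : R).
Hypotheses (p00 : 0 < p0) (x10 : 0 < x1) (L0 : 0 < L).
Hypothesis dF : forall x : R, `|x| < x1 -> is_derive x 1 F (p x).
Hypothesis pb : forall x, `|x| < x1 -> p0 / 2 <= p x <= 2 * p0.
Hypothesis pL : forall a b, `|a| < x1 -> `|b| < x1 -> `|p a - p b| <= L * `|a - b|.
Hypothesis F01 : forall x, 0 <= F x <= 1.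
Hypothesis Fnd : {homo F : x y / x <= y}.
Hypothesis F0 : F 0 = 2^-1.

(** The probabilities that j observations all exceed v + t, and that j observations
    are all at most v - t. *)
Definition none_above (j : nat) (v t : R) : R := (1 - F (v + t)) ^+ j.
Definition none_below (j : nat) (v t : R) : R := F (v - t) ^+ j.

Let dl := x1 / 4.
Let dl0 : 0 < dl. Proof. by rewrite divr_gt0. Qed.

Lemma F_slope a b : `|a| < x1 -> `|b| < x1 -> a <= b ->
  p0 / 2 * (b - a) <= F b - F a <= 2 * p0 * (b - a).
Proof.
move=> ha hb ab.
have inn t : a <= t <= b -> `|t| < x1.
  move: ha hb; rewrite !ltr_norml => /andP[a1 a2] /andP[b1 b2] /andP[t1 t2].
  by rewrite (lt_le_trans a1 t1) (le_lt_trans t2 b2).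
have h1 : F a - p0 / 2 * a <= F b - p0 / 2 * b.
  apply: (@drv_le R (fun t => F t - p0 / 2 * t) (fun t => p t - p0 / 2 * 1) a b ab) => t /inn ht.
  - exact: (drvB (dF ht) (drvZ (p0 / 2) (drv_id t))).
  - by have /andP[] := pb ht; lra.
have h2 : 2 * p0 * a - F a <= 2 * p0 * b - F b.
  apply: (@drv_le R (fun t => 2 * p0 * t - F t) (fun t => 2 * p0 * 1 - p t) a b ab) => t /inn ht.
  - exact: (drvB (drvZ (2 * p0) (drv_id t)) (dF ht)).
  - by have /andP[] := pb ht; lra.
by rewrite !mulrBr; apply/andP; split; lra.
Qed.

Section local.
Variables (j : nat) (v : R).
Hypotheses (j0 : (0 < j)%N) (hv : `|v| <= dl).
Notation A := (none_above j v).
Notation B := (none_below j v).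

Let in1 t : `|t| <= 2 * dl -> `|v + t| < x1.
Proof.
move=> ht; apply: (le_lt_trans (ler_normD _ _)).
apply: (le_lt_trans (lerD hv ht)); rewrite /dl; have := x10; lra.
Qed.

Let in2 t : `|t| <= 2 * dl -> `|v - t| < x1.
Proof. by move=> ht; apply: in1; rewrite normrN. Qed.

Definition d_none_above t : R := - (j%:R * (1 - F (v + t)) ^+ j.-1 * p (v + t)).
Definition d_none_below t : R := - (j%:R * F (v - t) ^+ j.-1 * p (v - t)).

Lemma none_above_drv (t : R) : `|t| <= 2 * dl -> is_derive t 1 A (d_none_above t).
Proof.
move=> ht; have d1 : is_derive t 1 (fun t : R => v + t) (0 + 1).
  exact: drvD (drv_cst _ _) (drv_id _).
apply: (is_derive_eq (drvX j (drvB (drv_cst 1 t) (drv_comp d1 (dF (in1 ht)))))).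
by rewrite /d_none_above; ring.
Qed.

Lemma none_below_drv (t : R) : `|t| <= 2 * dl -> is_derive t 1 B (d_none_below t).
Proof.
move=> ht; have d1 : is_derive t 1 (fun t : R => v - t) (0 - 1).
  exact: drvB (drv_cst _ _) (drv_id _).
apply: (is_derive_eq (drvX j (drv_comp d1 (dF (in2 ht))))).
by rewrite /d_none_below; ring.
Qed.

Let pn x : `|x| < x1 -> `|p x| <= 2 * p0.
Proof.
move=> hx; have /andP[h1 h2] := pb hx; rewrite ger0_norm// (le_trans _ h1)//.
by rewrite divr_ge0// ltW.
Qed.

Lemma d_none_above_bound t : `|t| <= 2 * dl -> `|d_none_above t| <= j%:R * (2 * p0).
Proof.
move=> ht; rewrite normrN normrM; have /andP[f0 f1] := F01 (v + t).
rewrite ler_pM ?pn ?in1// ger0_norm ?mulr_ge0 ?exprn_ge0 ?subr_ge0//.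
by rewrite ler_piMr// exprn_ile1 ?subr_ge0// lerBlDr lerDl.
Qed.

Lemma d_none_below_bound t : `|t| <= 2 * dl -> `|d_none_below t| <= j%:R * (2 * p0).
Proof.
move=> ht; rewrite normrN normrM; have /andP[f0 f1] := F01 (v - t).
rewrite ler_pM ?pn ?in2// ger0_norm ?mulr_ge0 ?exprn_ge0//.
by rewrite ler_piMr// exprn_ile1.
Qed.

Let lipg (f df : R -> R) (K : R) :
  (forall t : R, `|t| <= 2 * dl -> is_derive t 1 f (df t)) ->
  (forall t, `|t| <= 2 * dl -> `|df t| <= K) ->
  forall a b, `|a| <= 2 * dl -> `|b| <= 2 * dl -> `|f b - f a| <= K * `|b - a|.
Proof.
move=> df1 dfK.
have le a b : `|a| <= 2 * dl -> `|b| <= 2 * dl -> a <= b -> `|f b - f a| <= K * (b - a).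
  move=> ha hb ab; rewrite mulrBr.
  have /andP[a1 a2] : - (2 * dl) <= a <= 2 * dl by rewrite -ler_norml.
  have /andP[b1 b2] : - (2 * dl) <= b <= 2 * dl by rewrite -ler_norml.
  have inn t : a <= t <= b -> `|t| <= 2 * dl.
    by move=> /andP[t1 t2]; rewrite ler_norml (le_trans a1 t1) (le_trans t2 b2).
  have h2 t : a <= t <= b -> `|df t| <= K * 1 by move=> /inn /dfK; rewrite mulr1.
  have h1 t (h : a <= t <= b) := df1 t (inn t h).
  have h3 (t : R) (h : a <= t <= b) : is_derive t 1 (fun t : R => K * t) (K * 1).
    exact: (drvZ K (drv_id t)).
  exact: (drv_bound ab h1 h3 h2).
move=> a b ha hb; have [ab|/ltW ba] := leP a b.
  by rewrite [X in _ * X]ger0_norm ?subr_ge0// le.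
by rewrite distrC [X in _ * X]distrC [X in _ * X]ger0_norm ?subr_ge0// le.
Qed.

Lemma none_above_lip a b : `|a| <= 2 * dl -> `|b| <= 2 * dl ->
  `|A b - A a| <= j%:R * (2 * p0) * `|b - a|.
Proof. exact: (lipg none_above_drv d_none_above_bound). Qed.

Lemma none_below_lip a b : `|a| <= 2 * dl -> `|b| <= 2 * dl ->
  `|B b - B a| <= j%:R * (2 * p0) * `|b - a|.
Proof. exact: (lipg none_below_drv d_none_below_bound). Qed.

(** Think of H t as the probability that of 2j observations j lie on each side of v, that
    the nearest one above is further than t from v, and that it is at least as close
    as the nearest one below.  If it lies between t and t', then the nearest one
    below is certainly beyond t, and it suffices that it be beyond t'.  The factor C
    counts the choices of the j observations below. *)
Definition race_law (C : R) (H : R -> R) : Prop :=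
  (forall t t', 0 <= t -> t <= t' ->
     C * (B t' * (A t - A t')) <= H t - H t' <= C * (B t * (A t - A t'))) /\
  (forall t, 0 <= t -> 0 <= H t <= C * (A t * B t)).

(** H continued to negative t with the one-sided derivative it has at 0, so that
    0 becomes an interior point. *)
Let ext (C : R) (H : R -> R) (t : R) : R :=
  if 0 <= t then H t else H 0 + C * B 0 * (A t - A 0).

Lemma race_drv (C : R) (H : R -> R) : 0 <= C -> race_law C H ->
  forall t : R, 0 <= t <= dl -> is_derive t 1 (ext C H) (C * B t * d_none_above t).
Proof.
move=> C0 [hH _] t /andP[t0 td].
have tn : `|t| <= 2 * dl by rewrite ger0_norm//; have := dl0; lra.
pose K := C * (j%:R * (2 * p0)) * (j%:R * (2 * p0)).
have K0 : 0 <= K by rewrite !mulr_ge0// ltW.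
have dg : is_derive t 1 (fun u => C * B t * A u) (C * B t * d_none_above t).
  exact: drvZ (none_above_drv tn).
have inn u : 0 <= u -> u <= 2 * dl -> `|u| <= 2 * dl by move=> u0 ?; rewrite ger0_norm.
have key u u' : 0 <= u -> u <= u' -> u' <= 2 * dl ->
   `|C * (B u * (A u - A u')) - (H u - H u')| <= K * (u' - u) ^+ 2 /\
   `|C * (B u' * (A u - A u')) - (H u - H u')| <= K * (u' - u) ^+ 2.
  move=> u0 uu' u'd; have /andP[l r] := hH u u' u0 uu'.
  have iu : `|u| <= 2 * dl by apply: inn => //; exact: le_trans u'd.
  have iu' : `|u'| <= 2 * dl by apply: inn => //; exact: le_trans uu'.
  have q : C * (B u * (A u - A u')) - C * (B u' * (A u - A u')) <= K * (u' - u) ^+ 2.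
    rewrite -mulrBr -mulrBl /K -!mulrA ler_wpM2l//.
    apply: (le_trans (ler_norm _)); rewrite normrM.
    rewrite (_ : _ * _ = (j%:R * (2 * p0) * `|u - u'|) * (j%:R * (2 * p0) * `|u - u'|)); last first.
      by rewrite -(real_normK (num_real (u' - u))) distrC; ring.
    by rewrite ler_pM// ?none_above_lip// none_below_lip.
  by split; rewrite ler_norml; move: l r q; lra.
apply: (@quad_is_derive _ _ _ _ K (if t == 0 then dl else Num.min t dl) _ dg).
  case: eqVneq => [//|tn0]; by rewrite lt_min dl0 lt0r tn0 t0.
move=> y hy; rewrite /ext t0.
have [y0|yn] := leP 0 y; last first.
  have t00 : t = 0.
    move: hy; case: eqVneq => [//|tn0]; rewrite lt_min => /andP[+ _].
    by rewrite ltr_norml => /andP[+ _]; lra.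
  rewrite t00 [X in `|X|](_ : _ = 0); last by ring.
  by rewrite normr0 mulr_ge0 ?sqr_ge0.
have y2 : y <= 2 * dl.
  have : `|y - t| < dl by move: hy; case: ifP => // _; rewrite lt_min => /andP[].
  by rewrite ltr_norml => /andP[_]; move: td; lra.
have t2 : t <= 2 * dl by have := dl0; lra.
have [ty|/ltW yt] := leP t y.
  have [h _] := key t y t0 ty y2.
  by apply: le_trans h; rewrite le_eqVlt; apply/orP; left; apply/eqP; congr `|_|; ring.
have [_ h] := key y t y0 yt t2.
rewrite (_ : (y - t) ^+ 2 = (t - y) ^+ 2); last by ring.
apply: le_trans h.
rewrite -normrN le_eqVlt; apply/orP; left; apply/eqP; congr `|_|; ring.
Qed.

(** By the inequality of arithmetic and geometric means 4 (1 - F (v + t)) F (v - t) is at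
    most w^2, where w is the mass outside the interval (v - t, v + t]. *)
Let w_bound t : 0 <= t -> t <= dl ->
  0 <= 1 - F (v + t) + F (v - t) <= expR (- (p0 * t)) /\ p0 * t <= 1.
Proof.
move=> t0 td; have tn : `|t| <= 2 * dl by rewrite ger0_norm//; have := dl0; lra.
have /andP[f0 f1] := F01 (v + t); have /andP[g0 g1] := F01 (v - t).
have /andP[h _] : p0 / 2 * (v + t - (v - t)) <= F (v + t) - F (v - t) <=
    2 * p0 * (v + t - (v - t)).
  by apply: F_slope; [exact: in2|exact: in1|lra].
have e := expR_ge1Dx (- (p0 * t)).
have h' : p0 * t <= F (v + t) - F (v - t).
  by apply: le_trans h; rewrite le_eqVlt; apply/orP; left; apply/eqP; field.
by split; [apply/andP; split|]; move: f0 f1 g0 g1 h' e; lra.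
Qed.

Definition race_rate : R := 4 * (2 * L + 8 * p0 ^+ 2) * expR 2.

(** The derivative of H t minus F v times the probability that both neighbours are
    further than t. *)
Let psi' (C t : R) : R :=
  C * B t * d_none_above t - F v * (C * (d_none_above t * B t + A t * d_none_below t)).

(** The bracket left after taking out common factors vanishes at t = 0 and is Lipschitz
    in t; the remaining powers decay like exp(- 2 p0 j t), which gives the factor t
    an effective size 1/j. *)
Lemma race_derivative_bound (t : R) : 0 <= t -> t <= dl ->
  `|psi' ('C(j.*2, j)%:R) t| <=
  race_rate * (central_binom R j * j%:R) * (t * expR (- (2 * p0 * j%:R * t))).
Proof.
move=> t0 td; have [/andP[w0 wE] pt1] := w_bound t0 td.
have tn : `|t| <= 2 * dl by rewrite ger0_norm//; have := dl0; lra.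
have v0 : `|v| < x1 by rewrite -[v]addr0; apply: in1; rewrite normr0; have := dl0; lra.
have /andP[a0 a1] := F01 (v + t); have /andP[b0 b1] := F01 (v - t).
have /andP[f0 f1] := F01 v.
have /andP[q0 q1] := pb (in1 tn); have /andP[r0 r1] := pb (in2 tn).
have s1 : F (v + t) - F v <= 2 * p0 * t.
  have /andP[_] : p0 / 2 * (v + t - v) <= F (v + t) - F v <= 2 * p0 * (v + t - v).
    by apply: F_slope => //; [exact: in1|lra].
  by rewrite (_ : v + t - v = t)//; ring.
have s2 : F v - F (v - t) <= 2 * p0 * t.
  have /andP[_] : p0 / 2 * (v - (v - t)) <= F v - F (v - t) <= 2 * p0 * (v - (v - t)).
    by apply: F_slope => //; [exact: in2|lra].
  by rewrite (_ : v - (v - t) = t)//; ring.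
have s3 : F v <= F (v + t) by apply: Fnd; lra.
have s4 : F (v - t) <= F v by apply: Fnd; lra.
have s5 : `|p (v + t) - p (v - t)| <= 2 * L * t.
  apply: (le_trans (pL (in1 tn) (in2 tn))).
  by rewrite (_ : v + t - (v - t) = 2 * t) ?ger0_norm ?mulr_ge0//; [lra|ring].
have -> : psi' 'C(j.*2, j)%:R t = - (central_binom R j * 4 ^+ j * j%:R *
   ((1 - F (v + t)) * F (v - t)) ^+ j.-1 *
   ((1 - F v) * p (v + t) * F (v - t) - F v * (1 - F (v + t)) * p (v - t))).
  rewrite /psi' /none_above /none_below /d_none_above /d_none_below /central_binom mulfVK ?expf_neq0//.
  have pj (u : R) : u ^+ j = u * u ^+ j.-1 by rewrite -exprS prednK.
  by rewrite (pj (F _)) (pj (1 - _)) exprMn; ring.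
move: (F (v + t)) (F (v - t)) (F v) (p (v + t)) (p (v - t))
  w0 wE a0 a1 b0 b1 f0 f1 q0 q1 r0 r1 s1 s2 s3 s4 s5 => a b f q r *.
have brk : `|(1 - f) * q * b - f * (1 - a) * r| <= (2 * L + 8 * p0 ^+ 2) * t.
  have -> : (1 - f) * q * b - f * (1 - a) * r =
    (1 - f) * f * (q - r) + ((1 - f) * q * (b - f) + f * r * (a - f)) by ring.
  have pp := p00; have LL := L0.
  have qq0 : 0 <= q by lra.
  have rr0 : 0 <= r by lra.
  have ff0 : 0 <= 1 - f by lra.
  have ff1 : 1 - f <= 1 by lra.
  rewrite [leRHS]mulrDl; apply: (le_trans (ler_normD _ _)); apply: lerD.
    rewrite normrM ger0_norm ?mulr_ge0//.
    apply: (@le_trans _ _ (1 * (2 * L * t))); last by rewrite mul1r.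
    rewrite ler_pM// ?mulr_ge0//; apply: mulr_ile1 => //.
  rewrite (_ : 8 * p0 ^+ 2 * t = 1 * (2 * p0) * (2 * p0 * t) + 1 * (2 * p0) * (2 * p0 * t)); last by ring.
  apply: (le_trans (ler_normD _ _)); apply: lerD.
    rewrite normrM ger0_norm ?mulr_ge0// ler_pM ?mulr_ge0//; first by rewrite ler_pM.
    by rewrite ler_norml; lra.
  rewrite normrM ger0_norm ?mulr_ge0// ler_pM ?mulr_ge0//; first by rewrite ler_pM.
  by rewrite ler_norml; lra.
have ab0 : 0 <= (1 - a) * b by rewrite mulr_ge0//; lra.
have pw : (4 * ((1 - a) * b)) ^+ j.-1 <= expR (- (2 * p0 * j%:R * t)) * expR 2.
  apply: (@le_trans _ _ (expR (- (p0 * t)) ^+ 2 ^+ j.-1)).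
    rewrite lerXn2r ?nnegrE ?sqr_ge0 ?mulr_ge0//; last first.
      apply: (@le_trans _ _ ((1 - a + b) ^+ 2)); first by have := sqr_ge0 (1 - a - b); nra.
      by rewrite lerXn2r ?nnegrE ?expR_ge0.
    by lra.
  rewrite -exprM -expRM_natl -expRD ler_expR.
  have -> : (2 * j.-1)%:R = 2 * j%:R - 2 :> R.
    by rewrite -[in RHS](prednK j0) -natr1 natrM; ring.
  by have jj := p00; nra.
have c0 := ltW (central_binom_gt0 R j).
rewrite normrN normrM ger0_norm; last by rewrite !mulr_ge0 ?exprn_ge0.
have -> : central_binom R j * 4 ^+ j * j%:R * ((1 - a) * b) ^+ j.-1 =
   central_binom R j * j%:R * 4 * (4 * ((1 - a) * b)) ^+ j.-1.
  have pj (u : R) : u ^+ j = u * u ^+ j.-1 by rewrite -exprS prednK.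
  by rewrite pj [in RHS]exprMn; ring.
rewrite (_ : race_rate * _ * _ = central_binom R j * j%:R * 4 *
  (expR (- (2 * p0 * j%:R * t)) * expR 2) * ((2 * L + 8 * p0 ^+ 2) * t)); last first.
  by rewrite /race_rate; ring.
have c4 : 0 <= central_binom R j * j%:R * 4 by rewrite !mulr_ge0.
apply: ler_pM => //; last exact: ler_wpM2l.
by rewrite (mulr_ge0 c4)// exprn_ge0// mulr_ge0.
Qed.

Let expN_le (y : R) : 0 < y -> expR (- y) <= y^-1.
Proof.
move=> y0; rewrite expRN lef_pV2 ?posrE ?expR_gt0//.
by apply: le_trans (expR_ge1Dx y); rewrite lerDr.
Qed.

Lemma race_near (H : R -> R) : race_law 'C(j.*2, j)%:R H ->
  `|H 0 - F v * ('C(j.*2, j)%:R * (A 0 * B 0))| <=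
  (race_rate / (2 * p0) ^+ 2 + (2 * p0 * dl)^-1) * (central_binom R j / j%:R).
Proof.
set C : R := 'C(j.*2, j)%:R => hH; have [_ hH2] := hH.
have J0 : 0 < j%:R :> R by rewrite ltr0n.
have cb0 := central_binom_gt0 R j; have pp := p00; have dd := dl0.
have rr0 : 0 <= race_rate.
  by rewrite /race_rate !mulr_ge0 ?expR_ge0// addr_ge0 ?mulr_ge0 ?sqr_ge0// ltW.
pose Q := race_rate * (central_binom R j * j%:R).
pose c := 2 * p0 * j%:R.
have c0 : 0 < c by rewrite !mulr_gt0.
have Q0 : 0 <= Q by apply: mulr_ge0 => //; rewrite mulr_ge0// ltW.
pose G t := C * (A t * B t).
pose psi t := ext C H t - F v * G t.
(* An antiderivative of Q t exp(- c t). *)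
pose Th (t : R) : R := - (Q * ((t / c + c ^- 2) * expR (- (c * t)))).
have dTh (t : R) : is_derive t 1 Th (Q * (t * expR (- (c * t)))).
  apply: (is_derive_eq (drvN (drvZ Q (drvM (drvD (drvM (drv_id t) (drv_cst c^-1 t)) (drv_cst (c ^- 2) t))
    (drv_exp (drvN (drvZ c (drv_id t)))))))).
  by field; rewrite gt_eqF.
have dpsi (t : R) : 0 <= t <= dl -> is_derive t 1 psi (psi' C t).
  move=> ht; have tn : `|t| <= 2 * dl.
    by case/andP: ht => t0 t1; rewrite ger0_norm//; lra.
  apply: (drvB (race_drv (ler0n _ _) hH ht) (drvZ (F v) (drvZ C (drvM (none_above_drv tn) (none_below_drv tn))))).
have h1 : `|psi dl - psi 0| <= Th dl - Th 0.
  apply: (drv_bound (ltW dl0) dpsi (fun t _ => dTh t)) => t /andP[t0 td].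
  by rewrite /Q /c; exact: race_derivative_bound.
have h2 : Th dl - Th 0 <= race_rate / (2 * p0) ^+ 2 * (central_binom R j / j%:R).
  have -> : race_rate / (2 * p0) ^+ 2 * (central_binom R j / j%:R) = - Th 0.
    rewrite /Th mulr0 oppr0 expR0 mul0r add0r mulr1 opprK /Q /c; field.
    by rewrite !gt_eqF.
  rewrite gerDr /Th oppr_le0; apply: mulr_ge0 => //.
  apply: mulr_ge0; last exact: expR_ge0.
  apply: addr_ge0; first by apply: divr_ge0; exact: ltW.
  by rewrite invr_ge0; apply: exprn_ge0; exact: ltW.
have h3 : `|psi dl| <= (2 * p0 * dl)^-1 * (central_binom R j / j%:R).
  have /andP[e0 e1] := hH2 dl (ltW dl0); have /andP[f0 f1] := F01 v.
  apply: (@le_trans _ _ (G dl)).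
    rewrite /psi /ext (ltW dl0) -/(G dl); rewrite -/(G dl) in e1.
    have g0 : 0 <= G dl by exact: le_trans e1.
    have fg : 0 <= F v * G dl <= G dl by rewrite mulr_ge0//= ler_piMl.
    by rewrite ler_norml; move: fg e0 e1; lra.
  have [/andP[w0 wE] _] := w_bound (ltW dl0) (lexx dl).
  have /andP[a0 a1] := F01 (v + dl); have /andP[b0 b1] := F01 (v - dl).
  rewrite /G /C /none_above /none_below -exprMn.
  have -> : 'C(j.*2, j)%:R = central_binom R j * 4 ^+ j :> R by rewrite /central_binom mulfVK ?expf_neq0.
  rewrite -mulrA -exprMn [leRHS]mulrCA ler_wpM2l ?(ltW cb0)//.
  move: (F (v + dl)) (F (v - dl)) w0 wE a0 a1 b0 b1 => a b w0 wE a0 a1 b0 b1.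
  rewrite -invfM; apply: (le_trans _ (expN_le _)); last by rewrite !mulr_gt0.
  apply: (@le_trans _ _ (expR (- (p0 * dl)) ^+ 2 ^+ j)).
    rewrite lerXn2r ?nnegrE ?sqr_ge0 ?mulr_ge0//; last first.
      apply: (@le_trans _ _ ((1 - a + b) ^+ 2)); first by have := sqr_ge0 (1 - a - b); nra.
      by rewrite lerXn2r ?nnegrE ?expR_ge0.
    by lra.
  rewrite -exprM -expRM_natl ler_expR natrM.
  by rewrite le_eqVlt; apply/orP; left; apply/eqP; ring.
rewrite [X in `|X|](_ : _ = - (psi dl - psi 0) + psi dl); last first.
  by rewrite [psi 0]/psi /ext lexx /G; ring.
rewrite mulrDl.
apply: (le_trans (ler_normD _ _)); apply: lerD => //.
by rewrite normrN (le_trans h1).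
Qed.

End local.

(** Away from the median, exactly j observations below v is already an event of
    probability exponentially small in j. *)
Lemma race_far (j : nat) (v u0 : R) (H : R -> R) : (0 < j)%N -> 0 < u0 ->
  u0 <= `|2 * F v - 1| -> race_law j v 'C(j.*2, j)%:R H ->
  `|H 0 - F v * ('C(j.*2, j)%:R * (none_above j v 0 * none_below j v 0))| <=
  (u0 ^+ 2)^-1 * (central_binom R j / j%:R).
Proof.
move=> j0 u00 hu [_ hH2].
set C : R := 'C(j.*2, j)%:R in hH2 *.
have /andP[e0 e1] := hH2 0 (lexx 0); have /andP[f0 f1] := F01 v.
set G := C * _ in e1 *.
have g0 : 0 <= G by exact: le_trans e1.
apply: (@le_trans _ _ G).
  have fg : 0 <= F v * G <= G by rewrite mulr_ge0//= ler_piMl.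
  by rewrite ler_norml; move: fg e0 e1; lra.
rewrite /G /C /none_above /none_below addr0 subr0 -exprMn.
have -> : 'C(j.*2, j)%:R = central_binom R j * 4 ^+ j :> R by rewrite /central_binom mulfVK ?expf_neq0.
rewrite -mulrA -exprMn [leRHS]mulrCA ler_wpM2l ?(ltW (central_binom_gt0 R j))//.
set h := (2 * F v - 1) ^+ 2.
have hu2 : u0 ^+ 2 <= h.
  by rewrite /h -(real_normK (num_real (2 * F v - 1))) lerXn2r ?nnegrE ?(ltW u00).
have h0 : 0 < h by apply: lt_le_trans hu2; rewrite exprn_gt0.
have J0 : 0 < j%:R :> R by rewrite ltr0n.
have -> : 4 * ((1 - F v) * F v) = 1 - h by rewrite /h; ring.
have h1 : 0 <= 1 - h by rewrite /h; nra.
apply: (@le_trans _ _ (expR (- h) ^+ j)).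
  by rewrite lerXn2r ?nnegrE ?expR_ge0// expR_ge1Dx.
rewrite -expRM_natl -invfM mulrN expRN lef_pV2 ?posrE ?expR_gt0 ?mulr_gt0 ?exprn_gt0//.
apply: (@le_trans _ _ (1 + j%:R * h)); last exact: expR_ge1Dx.
by rewrite mulrC; apply: (@le_trans _ _ (j%:R * h)); rewrite ?lerDr ?ler_wpM2l ?(ltW J0).
Qed.

Lemma race_bound : exists2 K : R, 0 < K & forall (j : nat) (s v : R) (H : R -> R),
  (0 < j)%N -> 0 < s -> s ^+ 2 = j.*2%:R -> race_law j v 'C(j.*2, j)%:R H ->
  `|H 0 - F v * ('C(j.*2, j)%:R * (none_above j v 0 * none_below j v 0))| <= K / s ^+ 3.
Proof.
have pp := p00; have dd := dl0.
pose u0 := p0 * dl.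
have u00 : 0 < u0 by rewrite mulr_gt0.
pose K1 := race_rate / (2 * p0) ^+ 2 + (2 * p0 * dl)^-1.
have K10 : 0 < K1.
  rewrite /K1 ltr_wpDl ?invr_gt0 ?mulr_gt0// divr_ge0 ?sqr_ge0//.
  by rewrite /race_rate !mulr_ge0 ?expR_ge0// addr_ge0 ?mulr_ge0 ?sqr_ge0// ltW.
pose K2 := (u0 ^+ 2)^-1.
have K20 : 0 < K2 by rewrite invr_gt0 exprn_gt0.
exists (2 * (K1 + K2)); first by rewrite mulr_gt0// addr_gt0.
move=> j s v H j0 s0 sj hH.
have J0 : 0 < j%:R :> R by rewrite ltr0n.
have jE : j%:R = s ^+ 2 / 2 by rewrite sj -muln2 natrM mulfK.
have q : central_binom R j / j%:R <= 2 / s ^+ 3.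
  rewrite jE; apply: (@le_trans _ _ (s^-1 / (s ^+ 2 / 2))).
    by rewrite ler_wpM2r ?central_binom_le// invr_ge0 -jE ltW.
  by rewrite le_eqVlt; apply/orP; left; apply/eqP; field; rewrite gt_eqF.
have q0 : 0 <= central_binom R j / j%:R by rewrite divr_ge0// ltW// central_binom_gt0.
apply: (@le_trans _ _ ((K1 + K2) * (central_binom R j / j%:R))); last first.
  rewrite (_ : 2 * (K1 + K2) / s ^+ 3 = (K1 + K2) * (2 / s ^+ 3)); last by ring.
  by rewrite ler_wpM2l// addr_ge0// ltW.
have [vd|dv] := leP `|v| dl.
  apply: (le_trans (race_near j0 vd hH)).
  by rewrite ler_wpM2r// lerDl ltW.
apply: (le_trans (race_far j0 u00 _ hH)); last by rewrite ler_wpM2r// lerDr ltW.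
have x1d : dl < x1 by rewrite /dl; have := x10; lra.
have z1 : `|0 : R| < x1 by rewrite normr0.
have d1 : `|dl| < x1 by rewrite gtr0_norm.
have d2 : `|- dl| < x1 by rewrite normrN.
have /andP[g1 _] := F_slope z1 d1 (ltW dl0).
have /andP[g2 _] : p0 / 2 * (0 - - dl) <= F 0 - F (- dl) <= 2 * p0 * (0 - - dl).
  by apply: F_slope => //; rewrite oppr_le0 ltW.
rewrite F0 in g1 g2; rewrite /u0.
move: dv; rewrite ltNge ler_norml negb_and -!ltNge => /orP[vl|vr].
  have := Fnd (ltW vl) => g3; rewrite -normrN.
  by apply: le_trans (ler_norm _); move: g2 g3; lra.
have := Fnd (ltW vr) => g3.
by apply: le_trans (ler_norm _); move: g1 g3; lra.
Qed.

End race.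

(** * Laws of the middle order statistics *)
Section order_statistics.
Context (R : realType).
Implicit Types (s : seq R) (a : R).

Definition count_le a s : nat := count (fun x : R => x <= a) s.

Lemma order_stat_le s k a : (0 < k)%N -> (k <= size s)%N ->
  (order_stat s k <= a) = (k <= count_le a s)%N.
Proof.
case: k => // k _ ks; rewrite /order_stat /=.
set t := sort _ s.
have st : size t = size s by rewrite size_sort.
have -> : count_le a s = count_le a t.
  by apply/permP; rewrite perm_sym perm_sort.
have tt : sorted <=%R t by apply: sort_sorted; exact: le_total.
have mono i j : (i <= j)%N -> (j < size t)%N -> nth 0 t i <= nth 0 t j.
  move=> ij jt; apply: (sorted_leq_nth le_trans le_refl) => //.
  by rewrite inE (leq_ltn_trans ij).
apply/idP/idP => h.
  rewrite -(cat_take_drop k.+1 t) /count_le count_cat.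
  have sz : size (take k.+1 t) = k.+1 by rewrite size_takel// st.
  apply: leq_trans (leq_addr _ _).
  rewrite (_ : count _ _ = k.+1)// -[RHS]sz; apply/eqP; rewrite -all_count.
  apply/(all_nthP 0) => i; rewrite sz => ik; rewrite nth_take//.
  by apply: le_trans h; apply: mono => //; rewrite st.
rewrite leNgt; apply/negP => ak; move: h.
rewrite -(cat_take_drop k t) /count_le count_cat leqNgt => /negP; apply.
rewrite ltnS (_ : count _ (drop k t) = 0%N).
  by rewrite addn0 (leq_trans (count_size _ _))// size_take_min geq_minl.
apply/eqP; rewrite -leqn0 leqNgt -has_count -all_predC.
apply/(all_nthP 0) => i; rewrite size_drop => ik; rewrite nth_drop /= -ltNge.
apply: (lt_le_trans ak); apply: mono; first exact: leq_addr.
by rewrite -ltn_subRL.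
Qed.

Lemma order_stat_nd s k : (0 < k)%N -> (k < size s)%N ->
  order_stat s k <= order_stat s k.+1.
Proof.
case: k => // k _ ks; rewrite /order_stat /=.
have tt : sorted <=%R (sort <=%R s) by apply: sort_sorted; exact: le_total.
by apply: (sorted_leq_nth le_trans le_refl); rewrite // inE size_sort // ltnW.
Qed.

End order_statistics.

Section subsets.
Context (R : realType).

Lemma sum_card (m : nat) (Q : nat -> bool) (f : nat -> R) :
  \sum_(S : {set 'I_m} | Q #|S|) f #|S| =
  \sum_(c < m.+1 | Q c) 'C(m, c)%:R * f c.
Proof.
rewrite (partition_big (fun S : {set 'I_m} => (inord #|S| : 'I_m.+1)) (fun c : 'I_m.+1 => Q c)) /=; last first.
  move=> S QS; rewrite inordK// ltnS; apply: leq_trans (max_card _) _.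
  by rewrite card_ord.
apply: eq_bigr => c Qc.
have cS (S : {set 'I_m}) : (inord #|S| == c :> 'I_m.+1) = (#|S| == c).
  rewrite -val_eqE /= inordK// ltnS; apply: leq_trans (max_card _) _.
  by rewrite card_ord.
rewrite (eq_bigl (fun S : {set 'I_m} => #|S| == c)); last first.
  by move=> S; rewrite cS; case: eqP => [->|]; rewrite ?andbF// Qc.
rewrite (eq_bigr (fun _ => f c)); last by move=> S /eqP ->.
have -> : 'C(m, c) = #|[set S : {set 'I_m} | #|S| == c]%SET|.
  by rewrite card_draws card_ord.
rewrite sumr_const mulr_natl; congr (_ *+ _).
by apply: eq_card => S; rewrite !inE.
Qed.

Lemma sum_binom_tail (m k : nat) (q : R) :
  \sum_(S : {set 'I_m} | (k <= #|S|)%N) q ^+ #|S| * (1 - q) ^+ (m - #|S|) = binom_tail m k q.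
Proof.
rewrite (@sum_card m (fun c => (k <= c)%N) (fun c => q ^+ c * (1 - q) ^+ (m - c))).
by rewrite /binom_tail; apply: eq_bigr => c _; rewrite /binom_mass mulrA.
Qed.

Lemma sum_middle (j : nat) (f g : R) :
  \sum_(S : {set 'I_(j.*2)} | #|S| == j) f ^+ #|S| * g ^+ (j.*2 - #|S|) =
  'C(j.*2, j)%:R * (f ^+ j * g ^+ j).
Proof.
rewrite (@sum_card _ (fun c => c == j) (fun c => f ^+ c * g ^+ (j.*2 - c))).
have jj : (j < j.*2.+1)%N by rewrite ltnS -addnn leq_addr.
rewrite (big_pred1 (Ordinal jj)) => [|c] /=; last by [].
by rewrite /= -addnn addnK.
Qed.

End subsets.

Section iid.
Context d (T : measurableType d) (R : realType) (P : probability T R).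
Variables (X : nat -> {mfun T >-> R}) (G : R -> R).
Hypothesis ind : independent_rvs P X.
Hypothesis leG : forall i a, P (X i @^-1` `]-oo, a]) = (G a)%:E.
Hypothesis gtG : forall i a, P (X i @^-1` `]a, +oo[) = (1 - G a)%:E.

(** For a <= b these events, over all sets S of indices, are disjoint; the laws of
    the order statistics are obtained by summing over suitable S. *)
Definition pattern_event (m : nat) (a b : R) (S : {set 'I_m}) : set T :=
  [set w | forall i : 'I_m, if i \in S then X i w <= a else b < X i w].

Let side (m : nat) (a b : R) (S : {set 'I_m}) (i : nat) : set R :=
  if [exists k : 'I_m, (val k == i) && (k \in S)] then `]-oo, a]%classic else `]b, +oo[%classic.

Let sideE (m : nat) a b (S : {set 'I_m}) (i : 'I_m) :
  side a b S i = if i \in S then `]-oo, a]%classic else `]b, +oo[%classic.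
Proof.
rewrite /side; congr (if _ then _ else _).
apply/existsP/idP => [[k /andP[/eqP ki kS]]|iS].
  by rewrite -(val_inj ki).
by exists i; rewrite eqxx.
Qed.

Let side_measurable m a b (S : {set 'I_m}) i : measurable (side a b S i).
Proof. by rewrite /side; case: ifP => _; exact: measurable_itv. Qed.

Let pattern_eventE m a b (S : {set 'I_m}) : pattern_event a b S =
  \bigcap_(i in [set` [fset x | x in iota 0 m]%fset]) (X i @^-1` side a b S i).
Proof.
apply/seteqP; split => w /=.
  move=> h i /=; rewrite !inE /= mem_iota add0n => im.
  have := h (Ordinal im); rewrite -[i]/(val (Ordinal im)) sideE.
  by case: ifP => _ /=; rewrite in_itv/= ?andbT.
move=> h i; have := h (val i); rewrite /= !inE mem_iota add0n ltn_ord => /(_ isT).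
by rewrite sideE; case: ifP => _ /=; rewrite in_itv/= ?andbT.
Qed.

Lemma pattern_event_measurable m a b (S : {set 'I_m}) :
  measurable (pattern_event a b S).
Proof.
rewrite pattern_eventE; apply: fin_bigcap_measurable => // i _.
by rewrite -[X in measurable X]setTI; apply: measurable_funP.
Qed.

Lemma pattern_event_prob m a b (S : {set 'I_m}) :
  P (pattern_event a b S) = (G a ^+ #|S| * (1 - G b) ^+ (m - #|S|))%:E.
Proof.
rewrite pattern_eventE ind; last by move=> i _; exact: side_measurable.
rewrite (perm_big (iota 0 m)) /=; last first.
  apply: uniq_perm; rewrite ?fset_uniq ?iota_uniq// => i.
  by rewrite !inE.
rewrite -[m in iota 0 m]subn0 -/(index_iota 0 m) big_mkord.
rewrite (eq_bigr (fun i : 'I_m => (if i \in S then G a else 1 - G b)%:E)); last first.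
  by move=> i _; rewrite sideE; case: ifP => _; [exact: leG|exact: gtG].
rewrite prodEFin; congr EFin.
rewrite (bigID (fun i => i \in S)) /=.
rewrite (eq_bigr (fun=> G a)); last by move=> i ->.
rewrite prodr_const; congr (_ * _).
rewrite (eq_bigr (fun=> 1 - G b)); last by move=> i /negbTE ->.
rewrite prodr_const; congr (_ ^+ _).
have h := cardsC S; rewrite card_ord in h.
have -> : (m - #|S| = #|~: S|%SET)%N by move: h; lia.
by apply: eq_card => i; rewrite !inE.
Qed.

Lemma pattern_event_disj m a b (S S' : {set 'I_m}) w : a <= b ->
  pattern_event a b S w -> pattern_event a b S' w -> S = S'.
Proof.
move=> ab h h'; apply/setP => i; have := h i; have := h' i.
case: ifP => _; case: ifP => _ // u v.
  by move: (lt_le_trans v (le_trans u ab)); rewrite ltxx.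
by move: (lt_le_trans u (le_trans v ab)); rewrite ltxx.
Qed.

Lemma pattern_union m a b (Q : pred {set 'I_m}) : a <= b ->
  measurable [set w | exists2 S, Q S & pattern_event a b S w] /\
  P [set w | exists2 S, Q S & pattern_event a b S w] =
  (\sum_(S : {set 'I_m} | Q S) G a ^+ #|S| * (1 - G b) ^+ (m - #|S|))%:E.
Proof.
move=> ab.
have -> : [set w | exists2 S, Q S & pattern_event a b S w] =
  \bigcup_(S in [set` Q]) pattern_event a b S.
  by apply/seteqP; split => w [S QS hS]; exists S.
have fin : finite_set [set` Q] by exact: finite_finset.
split.
  by apply: fin_bigcup_measurable => // S _; exact: pattern_event_measurable.
rewrite measure_fin_bigcup//; last 2 first.
- move=> S S' _ _ [w [h h']]; exact: pattern_event_disj h h'.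
- by move=> S _; exact: pattern_event_measurable.
transitivity (\sum_(S : {set 'I_m} | Q S) P (pattern_event a b S))%E.
  rewrite [RHS]bigfs//; first exact: index_enum_uniq.
  by move=> S _; rewrite mem_index_enum.
rewrite -sumEFin; apply: eq_bigr => S _; exact: pattern_event_prob.
Qed.

End iid.

Section sample.
Context d (T : measurableType d) (R : realType) (P : probability T R).
Variables (X : nat -> {mfun T >-> R}) (G : R -> R).

Definition sample (m : nat) (w : T) : seq R := [seq X i w | i <- iota 0 m].

Definition below_set (m : nat) (a : R) (w : T) : {set 'I_m} :=
  [set i : 'I_m | X i w <= a]%SET.

Lemma size_sample m w : size (sample m w) = m.
Proof. by rewrite size_map size_iota. Qed.

Lemma count_below m a w : count_le a (sample m w) = #|below_set m a w|.
Proof.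
rewrite /count_le count_map cardsE cardE /enum_mem size_filter -enumT.
rewrite -[iota 0 m]val_enum_ord count_map.
by apply: eq_count.
Qed.

Lemma pattern_below m a b (S : {set 'I_m}) w : a <= b ->
  pattern_event X a b S w <-> S = below_set m a w /\ S = below_set m b w.
Proof.
move=> ab; split.
  move=> h; split; apply/setP => i; have := h i; rewrite inE; case: ifP => _.
  - by move=> ->.
  - by move=> /(le_lt_trans ab); rewrite ltNge => /negbTE.
  - by move=> /le_trans -> //.
  - by rewrite ltNge => /negbTE.
move=> [Sa Sb] i; case: ifP.
  by rewrite Sa inE.
by rewrite Sb inE => /negbT; rewrite -ltNge.
Qed.

Lemma order_stat_event m k a : (0 < k)%N -> (k <= m)%N ->
  [set w | order_stat (sample m w) k <= a] =
  [set w | exists2 S : {set 'I_m}, (k <= #|S|)%N & pattern_event X a a S w].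
Proof.
move=> k0 km; apply/seteqP; split => w /=.
  rewrite order_stat_le ?size_sample// count_below => h.
  by exists (below_set m a w) => //; apply/pattern_below.
move=> [S kS /(pattern_below _ _ (lexx a))[Sa _]].
by rewrite order_stat_le ?size_sample// count_below -Sa.
Qed.

(** The observations at most a and those at most b are both j in number, hence they
    are the same. *)
Lemma middle_event j a b : (0 < j)%N -> a <= b ->
  [set w | order_stat (sample j.*2 w) j <= a /\ b < order_stat (sample j.*2 w) j.+1] =
  [set w | exists2 S : {set 'I_(j.*2)}, #|S| == j & pattern_event X a b S w].
Proof.
move=> j0 ab; have j2 : (j.+1 <= j.*2)%N by lia.
have jj : (j <= j.*2)%N by lia.
apply/seteqP; split => w /=.
  rewrite ltNge !order_stat_le ?size_sample// !count_below -ltnNge ltnS => -[h1 h2].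
  have sub : below_set j.*2 a w \subset below_set j.*2 b w.
    by apply/fintype.subsetP => i; rewrite !inE => /le_trans; apply.
  have e : below_set j.*2 a w = below_set j.*2 b w.
    by apply/eqP; rewrite eqEcard sub (leq_trans h2).
  exists (below_set j.*2 a w); last by apply/pattern_below.
  by rewrite eqn_leq h1 andbT e.
move=> [S /eqP Sj /(pattern_below _ _ ab)[Sa Sb]].
rewrite ltNge !order_stat_le ?size_sample// !count_below -Sa -Sb Sj.
by rewrite leqnn ltnn.
Qed.

Hypothesis ind : independent_rvs P X.
Hypothesis leG : forall i a, P (X i @^-1` `]-oo, a]) = (G a)%:E.
Hypothesis gtG : forall i a, P (X i @^-1` `]a, +oo[) = (1 - G a)%:E.

Lemma order_stat_law m k a : (0 < k)%N -> (k <= m)%N ->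
  measurable [set w | order_stat (sample m w) k <= a] /\
  P [set w | order_stat (sample m w) k <= a] = (binom_tail m k (G a))%:E.
Proof.
move=> k0 km; rewrite order_stat_event//.
have [h1 h2] := pattern_union ind leG gtG (fun S : {set 'I_m} => (k <= #|S|)%N) (lexx a).
by split => //; rewrite h2 sum_binom_tail.
Qed.

Lemma middle_law j a b : (0 < j)%N -> a <= b ->
  measurable [set w | order_stat (sample j.*2 w) j <= a /\ b < order_stat (sample j.*2 w) j.+1] /\
  P [set w | order_stat (sample j.*2 w) j <= a /\ b < order_stat (sample j.*2 w) j.+1] =
  ('C(j.*2, j)%:R * (G a ^+ j * (1 - G b) ^+ j))%:E.
Proof.
move=> j0 ab; rewrite middle_event//.
have [h1 h2] := pattern_union ind leG gtG (fun S : {set 'I_(j.*2)} => #|S| == j) ab.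
by split => //; rewrite h2 sum_middle.
Qed.

Lemma order_stat_measurable m k : (0 < k)%N -> (k <= m)%N ->
  measurable_fun setT (fun w => order_stat (sample m w) k).
Proof.
move=> k0 km; apply: (measurability _ (RGenOInfty.measurableE R)).
move=> _ [_ [r ->] <-]; rewrite setTI.
rewrite (_ : _ @^-1` _ = ~` [set w | order_stat (sample m w) k <= r]).
  by apply: measurableC; have [] := order_stat_law r k0 km.
by apply/seteqP; split => w /=; rewrite in_itv/= andbT ltNge => /negP.
Qed.

Lemma sample_median_odd n w : sample_median X n.*2.+1 w = order_stat (sample n.*2.+1 w) n.+1.
Proof.
rewrite /sample_median -/(sample _ _) /seq_median size_sample /= odd_double /=.
by rewrite doubleK.
Qed.

Lemma sample_median_even j w : sample_median X j.*2 w =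
  (order_stat (sample j.*2 w) j + order_stat (sample j.*2 w) j.+1) / 2.
Proof.
by rewrite /sample_median -/(sample _ _) /seq_median size_sample odd_double doubleK.
Qed.

Lemma median_odd_law n y :
  fine (P [set w | sample_median X n.*2.+1 w <= y]) = odd_median_cdf n (2 * G y - 1).
Proof.
under eq_set => w do rewrite sample_median_odd.
have nn : (n.+1 <= n.*2.+1)%N by lia.
have [_ ->] := @order_stat_law n.*2.+1 n.+1 y isT nn.
by rewrite /= /odd_median_cdf; congr binom_tail; field.
Qed.

Section even.
Variables (j : nat) (y : R).
Hypothesis j0 : (0 < j)%N.
Notation C := ('C(j.*2, j)%:R : R).
Notation U := (fun w => order_stat (sample j.*2 w) j).
Notation V := (fun w => order_stat (sample j.*2 w) j.+1).

Definition straddle (a b : R) : set T := [set w | U w <= a /\ b < V w].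
(** At t = 0 this is the part of (U + V)/2 <= y on which V exceeds y; the parameter t
    is introduced to differentiate its probability. *)
Definition late_win (t : R) : set T := [set w | y + t < V w /\ U w + V w <= 2 * y].

Let pr (E : set T) : R := fine (P E).

Let prE E : measurable E -> P E = (pr E)%:E.
Proof. by move=> mE; rewrite /pr fineK// fin_num_measure. Qed.

Let mU : measurable_fun setT U.
Proof. by apply: order_stat_measurable => //; lia. Qed.

Let mV : measurable_fun setT V.
Proof. by apply: order_stat_measurable => //; lia. Qed.

Lemma late_win_measurable t : measurable (late_win t).
Proof.
have -> : late_win t = (V @^-1` `]y + t, +oo[) `&` ((fun w => U w + V w) @^-1` `]-oo, 2 * y]).
  by apply/seteqP; split => w /=; rewrite !in_itv/= andbT.
apply: measurableI; rewrite -[X in measurable X]setTI.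
  exact: mV.
by apply: measurable_funD.
Qed.

Lemma straddle_law a b : a <= b ->
  measurable (straddle a b) /\ pr (straddle a b) = C * (G a ^+ j * (1 - G b) ^+ j).
Proof. by move=> ab; have [h1 h2] := middle_law j0 ab; split => //; rewrite /pr h2. Qed.

Let pr_le E E' : measurable E -> measurable E' -> E `<=` E' -> pr E <= pr E'.
Proof.
move=> mE mE' EE'; rewrite -lee_fin -!prE//; apply: le_measure; rewrite ?inE//.
Qed.

Let pr_diff E E' : measurable E -> measurable E' -> E' `<=` E ->
  pr (E `\` E') = pr E - pr E'.
Proof.
move=> mE mE' EE'; apply: EFin_inj; rewrite EFinB -!prE//; last exact: measurableD.
rewrite measureD//; first by rewrite setIidr.
by rewrite ltey_eq fin_num_measure.
Qed.

Lemma middle_le w : U w <= V w.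
Proof. by apply: order_stat_nd => //; rewrite size_sample; lia. Qed.

(** If V lies in (y + t, y + t'], then U + V <= 2 y forces U < y - t and follows from
    U <= y - t'.  Both bounds are differences of [straddle] probabilities. *)
Lemma late_win_race (F : R -> R) (v : R) : (forall t, G (y + t) = F (v + t)) ->
  race_law F j v C (fun t => pr (late_win t)).
Proof.
move=> GF.
have GFm t : G (y - t) = F (v - t) by exact: GF.
have QE t t' : 0 <= t -> 0 <= t' -> measurable (straddle (y - t) (y + t')) /\
    pr (straddle (y - t) (y + t')) = C * (none_below F j v t * none_above F j v t').
  move=> t0 t0'; have [|h1 h2] := @straddle_law (y - t) (y + t'); first by lra.
  by split => //; rewrite h2 GFm GF.
split=> [t t' t0 tt'|t t0].
  have t0' : 0 <= t' by exact: le_trans tt'.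
  have dl : late_win t' `<=` late_win t.
    by move=> w [h1 h2]; split => //; apply: le_lt_trans h1; rewrite lerD2l.
  rewrite -pr_diff//; [|exact: late_win_measurable|exact: late_win_measurable].
  have sub a : straddle a (y + t') `<=` straddle a (y + t).
    by move=> w [h1 h2]; split => //; apply: le_lt_trans h2; rewrite lerD2l.
  have [m1 e1] := QE t t t0 t0; have [m2 e2] := QE t t' t0 t0'.
  have [m3 e3] := QE t' t t0' t0; have [m4 e4] := QE t' t' t0' t0'.
  rewrite !mulrBr -e1 -e2 -e3 -e4 -!pr_diff//.
  have mL := late_win_measurable.
  apply/andP; split; apply: pr_le; try exact: measurableD.
  - move=> w [[u1 u2] u3]; split.
      split => //; have vt : V w <= y + t' by rewrite leNgt; apply/negP => h; exact: u3.
      by lra.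
    by move=> [h1 h2]; apply: u3.
  - move=> w [[u1 u2] u3]; split.
      split => //; lra.
    by move=> [h1 h2]; apply: u3.
have [m1 e1] := QE t t t0 t0.
rewrite [X in C * X]mulrC -e1 /pr fine_ge0//=.
apply: pr_le => //; first exact: late_win_measurable.
by move=> w [u1 u2]; split => //; lra.
Qed.

(** With q = G y, the recursion for binomial tails gives the odd-sample tail as the
    probability of V <= y plus q times the probability that exactly j observations
    are at most y. *)
Lemma median_even_law :
  fine (P [set w | sample_median X j.*2 w <= y]) =
  odd_median_cdf j (2 * G y - 1) + (pr (late_win 0) - G y * (C * ((1 - G y) ^+ j * G y ^+ j))).
Proof.
have vv : (j.+1 <= j.*2)%N by lia.
have [mVy eVy] := @order_stat_law j.*2 j.+1 y isT vv.
have -> : [set w | sample_median X j.*2 w <= y] = [set w | V w <= y] `|` late_win 0.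
  apply/seteqP; split => w /=; rewrite sample_median_even ler_pdivrMr// mulrC.
    by move=> h; have [] := leP (V w) y; [left|right; split => //; rewrite addr0].
  by have := middle_le w; move=> uv [h|[_ //]]; lra.
set VL := [set w | V w <= y].
have -> : P (VL `|` late_win 0) = (P VL + P (late_win 0))%E.
  apply: measureU => //; first exact: late_win_measurable.
  apply/seteqP; split => w //= [h1 [h2 _]]; move: h2; rewrite addr0 => /(le_lt_trans h1).
  by rewrite ltxx.
rewrite eVy (prE (late_win_measurable 0)) /=.
have -> : odd_median_cdf j (2 * G y - 1) = binom_tail j.*2.+1 j.+1 (G y).
  by rewrite /odd_median_cdf; congr binom_tail; field.
rewrite binom_tail_rec (binom_tailS j.*2 j) /binom_mass -addnn addnK; ring.
Qed.

End even.

End sample.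

(** * The expansion for all sample sizes *)
Section location.
Context (R : realType) (p : R -> R) (dp : is_density p).
Context d (T : measurableType d) (P : R -> probability T R) (X : nat -> {mfun T >-> R}).
Hypothesis hX : location_sample p P X.

Lemma sample_le (theta : R) i a :
  P theta (X i @^-1` `]-oo, a]) = (density_cdf p (a - theta))%:E.
Proof.
have [_ hd] := hX theta.
rewrite (hd i `]-oo, a]%classic); first exact: (density_cdf_shift dp).
exact: measurable_itv.
Qed.

Lemma sample_gt (theta : R) i a :
  P theta (X i @^-1` `]a, +oo[) = (1 - density_cdf p (a - theta))%:E.
Proof.
have -> : X i @^-1` `]a, +oo[ = ~` (X i @^-1` `]-oo, a]).
  by apply/seteqP; split => w /=; rewrite !in_itv/= andbT ltNge => /negP.
rewrite probability_setC; first by rewrite sample_le.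
by rewrite -[X in measurable X]setTI; apply: measurable_funP.
Qed.

End location.

Lemma powR_3_2 (R : realType) (m : R) : 0 <= m -> m `^ (3 / 2) = Num.sqrt m ^+ 3.
Proof.
move=> m0; rewrite mulrC powRrM powR12_sqrt// -[3]/(3%:R).
by rewrite powR_mulrn// sqrtr_ge0.
Qed.

Theorem proposition2p1 (R : realType) (p : R -> R) (hp : assumptionA p) :
  exists C1 : R,
    forall (d : measure_display) (T : measurableType d)
           (P : R -> probability T R) (X : nat -> {mfun T >-> R}),
      location_sample p P X ->
      forall (theta : R) (m : nat), (2 <= m)%N ->
        let s : R := Num.sqrt (mstar m)%:R in
        (ereal_sup
           [set `| fine (P theta
                     [set w | (2 * p 0 * s * (sample_median X m w - theta) <= x)%R])
                   - std_normal_cdf x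
                   - f1 p x / s
                   - f2 p x / (mstar m)%:R |%:E | x in [set: R]]
         <= (C1 / (m%:R `^ (3 / 2)))%:E)%E.
Proof.
have dp := assumptionA_density hp; have pp := p0_gt0 hp.
have [x1 [M [[x10 M0] dF pb pL _]]] := local_cdf hp.
have F01 x : 0 <= density_cdf p x <= 1 by rewrite density_cdf_ge0 ?density_cdf_le1.
have [Kr Kr0 race] := race_bound pp x10 M0 dF pb pL F01 (density_cdf_nd dp) (density_cdf_half hp).
have [Ke Ke0 expan] := odd_median_expansion hp.
(* Since m <= 4 s^2, the factor 8 converts s^-3 into m^(-3/2). *)
exists (8 * (Kr + Ke)) => d T P X hX theta m m2; cbv zeta.
set s : R := Num.sqrt _.
pose n := m./2.
have n0 : (0 < n)%N by rewrite /n; lia.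
have ms : mstar m = n.*2 by rewrite /mstar mul2n.
have s2 : s ^+ 2 = n.*2%:R by rewrite /s ms sqr_sqrtr.
have s0 : 0 < s by rewrite /s ms sqrtr_gt0 ltr0n double_gt0.
have sN0 : s != 0 by rewrite gt_eqF.
have Es : (Kr + Ke) / s ^+ 3 <= 8 * (Kr + Ke) / (m%:R `^ (3 / 2)).
  rewrite powR_3_2// ler_pdivlMr ?exprn_gt0 ?sqrtr_gt0 ?ltr0n//; last by lia.
  rewrite mulrAC ler_pdivrMr ?exprn_gt0//.
  rewrite (_ : 8 * (Kr + Ke) * s ^+ 3 = (Kr + Ke) * (8 * s ^+ 3)); last by ring.
  rewrite ler_wpM2l ?addr_ge0 ?(ltW Kr0) ?(ltW Ke0)//.
  rewrite (_ : 8 * s ^+ 3 = (2 * s) ^+ 3); last by ring.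
  rewrite lerXn2r ?nnegrE ?sqrtr_ge0 ?mulr_ge0 ?(ltW s0)//.
  rewrite -(@ler_pXn2r _ 2) ?nnegrE ?sqrtr_ge0 ?mulr_ge0 ?(ltW s0)//.
  rewrite sqr_sqrtr// exprMn s2 -natrX -natrM ler_nat /n; lia.
apply: ge_ereal_sup => _ [x _ <-]; rewrite lee_fin.
apply: le_trans Es.
have [ind _] := hX theta.
pose G a := density_cdf p (a - theta).
have leG := sample_le dp hX theta; have gtG := sample_gt dp hX theta.
pose v := x / (2 * p 0 * s); pose y := theta + v.
have Gy : G y = density_cdf p v by rewrite /G /y addrAC subrr add0r.
have -> : [set w | 2 * p 0 * s * (sample_median X m w - theta) <= x] =
          [set w | sample_median X m w <= y].
  have c0 : 0 < 2 * p 0 * s by rewrite !mulr_gt0.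
  apply/seteqP; split => w /=.
    by rewrite mulrC -ler_pdivlMr// /y -lerBlDl.
  by rewrite mulrC -ler_pdivlMr// /y -lerBlDl.
have law : `|fine (P theta [set w | sample_median X m w <= y]) - odd_median_cdf n (2 * density_cdf p v - 1)|
    <= Kr / s ^+ 3.
  have [mo|me] := boolP (odd m).
    have mE : m = n.*2.+1 by rewrite /n; lia.
    rewrite mE (median_odd_law ind leG gtG) -/(G y) Gy subrr normr0.
    by rewrite divr_ge0 ?exprn_ge0// ltW.
  have mE : m = n.*2 by rewrite /n; lia.
  rewrite mE (median_even_law ind leG gtG)// -/(G y) Gy addrAC subrr add0r.
  have GF t : G (y + t) = density_cdf p (v + t) by rewrite /G /y; congr density_cdf; ring.
  have := race n s v _ n0 s0 s2 (late_win_race ind leG gtG n0 GF).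
  by rewrite /none_above /none_below addr0 subr0.
have -> : fine (P theta [set w | sample_median X m w <= y]) - std_normal_cdf x - f1 p x / s
    - f2 p x / (mstar m)%:R =
  (fine (P theta [set w | sample_median X m w <= y]) - odd_median_cdf n (2 * density_cdf p v - 1)) +
  median_error p n s x.
  rewrite /median_error -/v ms -s2; ring.
rewrite [leRHS]mulrDl; apply: (le_trans (ler_normD _ _)); apply: lerD => //.
exact: expan.
Qed.
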